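(* Let $f\in\mathcal S^0_{\mu_f}(\mathcal X)$ with $\mu_f\ge 0$ and $g\in\mathcal S^0_{\mu_g}(\mathcal Y)$ with $\mu_g\ge 0$. Let $\{\beta_k\}_{k\ge1}$ be a positive nondecreasing sequence with $\lim_{k\to+\infty}\beta_k=+\infty$, let $\{\alpha_k\}_{k\ge1}$ be a positive sequence, and suppose that $\delta,\gamma>0$ satisfy, for every $k\ge 1$, $$\delta\gamma-1\ge 0,\qquad \delta\beta_{k+1}\le \delta\beta_k+\alpha_k\beta_k .$$ Let $\{(x_k,y_k,\lambda_k)\}_{k\ge1}$ be the sequence generated by the Primal-dual Joint Algorithm (defined in the context), and let $(x^*,y^*,\lambda^* )\in\Omega$ (so $\Omega\neq\emptyset$). Assume that $\{\epsilon_k\}_{k\ge1}$ is a nonincreasing sequence of nonnegative numbers satisfying $\sum_{k=1}^{+\infty}\alpha_k\epsilon_k<+\infty$ and $\lim_{k\to+\infty}\beta_k\epsilon_k=+\infty$. Let $(\bar x^*,\bar y^* )$ be the element of minimal norm of the solution set $\mathbb S$. Then $$\liminf_{k\to+\infty}\|(x_k,y_k)-(\bar x^*,\bar y^* )\|=0 .$$ Further, if there exists an integer $K\ge1$ such that the sequence $\{(x_k,y_k)\}_{k\ge K}$ stays in either the open ball $B\big(0,\sqrt{\|\bar x^*\|^2+\|\bar y^*\|^2}\big)$ of $\mathcal X\times\mathcal Y$ or its complement, then $$\lim_{k\to+\infty}\|(x_k,y_k)-(\bar x^*,\bar y^* )\|=0 .$$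
   Context: $\mathcal X,\mathcal Y,\mathcal Z$ are real Hilbert spaces; $\mathcal X\times\mathcal Y$ carries the product norm $\|(x,y)\|^2=\|x\|^2+\|y\|^2$. The problem is $\min_{x\in\mathcal X,y\in\mathcal Y}\Phi(x,y):=f(x)+g(y)$ subject to $Ax+By=b$, where $f:\mathcal X\to\mathbb R\cup\{+\infty\}$, $g:\mathcal Y\to\mathbb R\cup\{+\infty\}$ are proper, convex, lower semicontinuous, $A:\mathcal X\to\mathcal Z$, $B:\mathcal Y\to\mathcal Z$ are continuous linear operators, $b\in\mathcal Z$, and the set $\mathbb S$ of optimal solutions is nonempty. $(\bar x^*,\bar y^* )=\mathrm{proj}_{\mathbb S}0$, where $\mathrm{proj}$ is the metric projection. $\mathcal S^0_\mu(\mathcal X)$ ($\mu\ge0$) is the set of proper, closed, lower semicontinuous convex functions $f$ on $\mathcal X$ such that $f(x_1)-f(x_2)-\langle w,x_1-x_2\rangle\ge\frac\mu2\|x_1-x_2\|^2$ for all $x_1,x_2\in\mathcal X$ and $w\in\partial f(x_2)$ (convex subdifferential); similarly for $\mathcal Y$. Lagrangian: $\mathcal L(x,y,\lambda)=f(x)+g(y)+\langle\lambda,Ax+By-b\rangle$. Augmented Lagrangian: $\mathcal L_\theta(x,y,\lambda)=\mathcal L(x,y,\lambda)+\frac\theta2\|Ax+By-b\|^2$. $\Omega$ is the set of saddle points: $(x^*,y^*,\lambda^* )\in\Omega$ iff $\mathcal L(x^*,y^*,\lambda)\le\mathcal L(x^*,y^*,\lambda^* )\le\mathcal L(x,y,\lambda^*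 )$ for all $(x,y,\lambda)\in\mathcal X\times\mathcal Y\times\mathcal Z$. Primal-dual Joint Algorithm. Parameters: $\delta>0$, $\gamma>0$, sequences $\alpha_k>0$, $\beta_k>0$, $\epsilon_k\ge0$. Initialize $x_1=x_0=\frac1\gamma Z_1$, $y_1=y_0=\frac1\gamma H_1$, $\lambda_1=\lambda_0$. For $k=1,2,\dots$: set $\theta_k=(\alpha_k+\delta)\beta_k$, $\eta_{f,k}=\gamma+\frac1{\alpha_k}+\mu_f\delta\beta_k$, $\eta_{g,k}=\gamma+\frac1{\alpha_k}+\mu_g\delta\beta_k$, $\widetilde\lambda_k=\lambda_k-\delta\beta_k(Ax_k+By_k-b)$, $\widetilde x_k=x_k+\frac{Z_k-\gamma x_k}{\eta_{f,k}}$, $\widetilde y_k=y_k+\frac{H_k-\gamma y_k}{\eta_{g,k}}$, and $$(x_{k+1},y_{k+1})=\arg\min_{(x,y)\in\mathcal X\times\mathcal Y}\Big(\mathcal L_{\theta_k}(x,y,\widetilde\lambda_k)+\frac{\eta_{f,k}}{2\alpha_k\beta_k}\|x-\widetilde x_k\|^2+\frac{\eta_{g,k}}{2\alpha_k\beta_k}\|y-\widetilde y_k\|^2+\frac{\epsilon_k}2\|x\|^2+\frac{\epsilon_k}2\|y\|^2\Big);$$ then $(Z_{k+1},H_{k+1})=(\gamma+\frac1{\alpha_k})(x_{k+1},y_{k+1})-\frac1{\alpha_k}(x_k,y_k)$, $(Z^\delta_{k+1},H^\delta_{k+1})=\delta(Z_{k+1},H_{k+1})+(1-\delta\gamma)(x_{k+1},y_{k+1})$,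 and $\lambda_{k+1}=\lambda_k+\alpha_k\beta_k(AZ^\delta_{k+1}+BH^\delta_{k+1}-b)$. *)

(* Defs.v *)
From HB Require Import structures.
From mathcomp Require Import all_boot all_order all_algebra.
From mathcomp Require Import all_classical all_reals all_analysis.

Set Implicit Arguments.
Unset Strict Implicit.
Unset Printing Implicit Defensive.

Import Order.TTheory GRing.Theory Num.Theory.
Import numFieldNormedType.Exports.

Local Open Scope classical_set_scope.
Local Open Scope ring_scope.

(* Real Hilbert spaces: the norm carried by the complete normed module is the
   one induced by the inner product. *)
HB.mixin Record CompleteNormedModule_isHilbert (R : realType) V
    of CompleteNormedModule R V := {
  inner : {dot V for @idfun R} ;
  inner_norm : forall u : V, inner u u = `|u| ^+ 2
}.

#[short(type="hilbertType")]
HB.structure Definition Hilbert (R : realType) :=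
  {V of CompleteNormedModule R V & CompleteNormedModule_isHilbert R V}.

Section ConvexFunctions.
Context {R : realType} {V : hilbertType R}.
Implicit Types (f : V -> \bar R) (u v w : V).
Local Open Scope ereal_scope.

Definition proper_fun f : Prop :=
  (forall u, f u != -oo) /\ (exists u, f u != +oo).

(* At t = 0 and t = 1 the products use the convention 0 * +oo = 0. *)
Definition convex_efun f : Prop :=
  forall u v (t : R), (0 <= t <= 1)%R ->
    f (t *: u + (1 - t) *: v)%R <= t%:E * f u + (1 - t)%:E * f v.

Definition closed_fun f : Prop :=
  closed [set p : V * R | f p.1 <= p.2%:E].

(* Empty at every u with f u = +oo as soon as f is proper. *)
Definition subdifferential f u : set V :=
  [set w | forall v, f u + (inner w (v - u)%R)%:E <= f v].

Definition S0 (mu : R) : set (V -> \bar R) :=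
  [set f | [/\ proper_fun f, closed_fun f, lower_semicontinuous f,
    convex_efun f &
    forall u v w, subdifferential f v w ->
      (mu / 2 * `|u - v| ^+ 2)%:E <= f u - f v - (inner w (u - v)%R)%:E]].

End ConvexFunctions.

Section ProductSpace.
Context {R : realType} {X Y : hilbertType R}.
Implicit Types (p q c : X * Y).

(* The canonical norm on X * Y in the library is the max norm, hence an
   explicit Hilbert product norm. *)
Definition pnorm p : R := Num.sqrt (`|p.1| ^+ 2 + `|p.2| ^+ 2).

Definition pball c (r : R) : set (X * Y) := [set p | pnorm (p - c) < r].

Definition is_proj (S : set (X * Y)) p q : Prop :=
  S q /\ forall s, S s -> pnorm (p - q) <= pnorm (p - s).

End ProductSpace.

Definition is_argmin {R : realType} {T : Type} (F : T -> \bar R) (p : T) :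
  Prop := forall q, (F p <= F q)%E.

Section Problem.
Context {R : realType} {X Y Z : hilbertType R}.
Variables (f : X -> \bar R) (g : Y -> \bar R).
Variables (A : {linear X -> Z}) (B : {linear Y -> Z}) (b : Z).

Definition solutions : set (X * Y) :=
  [set p | A p.1 + B p.2 = b /\
    forall q : X * Y, A q.1 + B q.2 = b ->
      (f p.1 + g p.2 <= f q.1 + g q.2)%E].

Definition lagrangian (x : X) (y : Y) (lam : Z) : \bar R :=
  (f x + g y + (inner lam (A x + B y - b)%R)%:E)%E.

Definition aug_lagrangian (theta : R) (x : X) (y : Y) (lam : Z) : \bar R :=
  (lagrangian x y lam + (theta / 2 * `|A x + B y - b| ^+ 2)%:E)%E.

Definition saddle_points : set (X * Y * Z) :=
  [set s | let: (xs, ys, ls) := s in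
    forall (x : X) (y : Y) (lam : Z),
      (lagrangian xs ys lam <= lagrangian xs ys ls)%E /\
      (lagrangian xs ys ls <= lagrangian x y ls)%E].

Variables (mu_f mu_g delta gamma : R) (alpha beta eps : nat -> R).

(* The sequences (x_k), (y_k), (lam_k), (Z_k), (H_k) are produced by the
   primal-dual joint algorithm; z and h stand for (Z_k) and (H_k). The values
   alpha 0, beta 0, eps 0, z 0 and h 0 play no role. *)
Definition joint_algorithm (x : nat -> X) (y : nat -> Y) (lam : nat -> Z)
    (z : nat -> X) (h : nat -> Y) : Prop :=
  [/\ x 1%N = x 0%N /\ x 0%N = gamma^-1 *: z 1%N,
      y 1%N = y 0%N /\ y 0%N = gamma^-1 *: h 1%N,
      lam 1%N = lam 0%N
    & forall k : nat, (1 <= k)%N ->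
      let theta := (alpha k + delta) * beta k in
      let eta_f := gamma + (alpha k)^-1 + mu_f * delta * beta k in
      let eta_g := gamma + (alpha k)^-1 + mu_g * delta * beta k in
      let lamt := lam k - (delta * beta k) *: (A (x k) + B (y k) - b) in
      let xt := x k + eta_f^-1 *: (z k - gamma *: x k) in
      let yt := y k + eta_g^-1 *: (h k - gamma *: y k) in
      let zd := delta *: z k.+1 + (1 - delta * gamma) *: x k.+1 in
      let hd := delta *: h k.+1 + (1 - delta * gamma) *: y k.+1 in
      [/\ is_argmin (fun p : X * Y =>
            (aug_lagrangian theta p.1 p.2 lamt +
             (eta_f / (2 * alpha k * beta k) * `|p.1 - xt| ^+ 2 +
              eta_g / (2 * alpha k * beta k) * `|p.2 - yt| ^+ 2 +
              eps k / 2 * `|p.1| ^+ 2 + eps k / 2 * `|p.2| ^+ 2)%R%:E)%E)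
            (x k.+1, y k.+1),
          z k.+1 = (gamma + (alpha k)^-1) *: x k.+1 - (alpha k)^-1 *: x k,
          h k.+1 = (gamma + (alpha k)^-1) *: y k.+1 - (alpha k)^-1 *: y k
        & lam k.+1 = lam k + (alpha k * beta k) *: (A zd + B hd - b)]].

End Problem.

(* Main.v *)
(** Fix the saddle point multiplier and take the minimal norm solution as
    reference point. The optimality conditions of the subproblems make
      delta^2 beta_k (gap_k + eps_k/2 |w_k|^2) + (squared distances)
    grow by at most O(alpha_k beta_k eps_k) per step, where w_k = (x_k, y_k) and
    gap_k is the Lagrangian gap at w_k. By Kronecker's lemma this energy is
    o(beta_k), so the gap tends to 0; the multipliers are o(sqrt beta_k), and the
    multiplier update turns this into a vanishing constraint residual. When
    |w_k| is eventually at least the minimal norm, the energy with |w_k|^2 replaced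
    by |w_k|^2 minus the squared minimal norm is nonincreasing, and
    beta_k eps_k -> +oo forces |w_k| to approach the minimal norm.
    Finally, an almost feasible, almost optimal point whose norm hardly exceeds
    the minimal one is close to the minimal norm solution. This covers both
    cases of the second claim; in the remaining case w_k is infinitely often
    inside the ball, which gives the liminf. *)
Require Import Defs.
From HB Require Import structures.
From mathcomp Require Import all_boot all_order all_algebra.
From mathcomp Require Import all_classical all_reals all_analysis.
From mathcomp Require Import ring lra.
Import Order.TTheory GRing.Theory Num.Theory.
Import numFieldNormedType.Exports.
Local Open Scope classical_set_scope.
Local Open Scope ring_scope.

(** * Inner product calculus and the Cauchy-Schwarz inequality *)

Section HilbertSpace.
Context {R : realType} {V : hilbertType R}.
Implicit Types u v w : V.

Lemma innerC u v : inner u v = inner v u.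
Proof. by rewrite hermC /= expr0 mul1r. Qed.

Lemma innerDl u v w : inner (u + v) w = inner u w + inner v w.
Proof. exact: linearDl. Qed.

Lemma innerDr u v w : inner w (u + v) = inner w u + inner w v.
Proof. exact: linearDr. Qed.

Lemma innerNl u w : inner (- u) w = - inner u w.
Proof. exact: linearNl. Qed.

Lemma innerNr u w : inner w (- u) = - inner w u.
Proof. exact: linearNr. Qed.

Lemma innerZl (a : R) u w : inner (a *: u) w = a * inner u w.
Proof. exact: linearZl_LR. Qed.

Lemma innerZr (a : R) u w : inner w (a *: u) = a * inner w u.
Proof. exact: linearZr_LR. Qed.

Definition innerE := (innerDl, innerDr, innerNl, innerNr, innerZl, innerZr).

Lemma inner0r u : inner u 0 = 0.
Proof. exact: linear0r. Qed.

(** Testing against [u - v] is enough. The lemma serves to reduce vector identities to scalar ones,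
    which [ring] or [field] can settle. *)
Lemma inner_inj u v : (forall w, inner u w = inner v w) -> u = v.
Proof.
move=> uv; apply/eqP; rewrite -subr_eq0 -normr_eq0 -sqrf_eq0 -inner_norm.
by rewrite innerDl innerNl uv subrr.
Qed.

Lemma sqr_normD u v : `|u + v| ^+ 2 = `|u| ^+ 2 + `|v| ^+ 2 + 2 * inner u v.
Proof. by rewrite -!inner_norm !innerE (innerC v u); ring. Qed.

Lemma sqr_normB u v : `|u - v| ^+ 2 = `|u| ^+ 2 + `|v| ^+ 2 - 2 * inner u v.
Proof. by rewrite -!inner_norm !innerE (innerC v u); ring. Qed.

Lemma sqr_normZ (a : R) u : `|a *: u| ^+ 2 = a ^+ 2 * `|u| ^+ 2.
Proof. by rewrite -!inner_norm !innerE; ring. Qed.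

(** The squared norm of [|v| u - |u| v] expands to [2 |u| |v|] times the difference of the two
    sides. *)
Lemma cauchy_schwarz u v : inner u v <= `|u| * `|v|.
Proof.
have [->|u0] := eqVneq u 0; first by rewrite innerC inner0r normr0 mul0r.
have [->|v0] := eqVneq v 0; first by rewrite inner0r normr0 mulr0.
have := sqr_ge0 (`| `|v| *: u - `|u| *: v|).
rewrite sqr_normB !sqr_normZ !innerE.
have : 0 < `|u| * `|v| by rewrite mulr_gt0 ?normr_gt0.
set c := inner u v; set a := `|u|; set b := `|v| => ab0 ineq.
rewrite -subr_ge0 -(pmulr_rge0 _ ab0).
rewrite -(pmulr_rge0 _ (ltr0Sn R 1)).
by apply: le_trans ineq _; rewrite le_eqVlt; apply/orP; left; apply/eqP; ring.
Qed.

End HilbertSpace.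

(** * Almost-minimal elements of nested midpoint-convex sets *)

Section MinimizingSequences.
Context {R : realType}.

(** The bound concerns squared distances and depends on the smaller index only, which is the form
    that the parallelogram law produces. *)
Lemma cvg_of_tail_bound (V : completeNormedModType R) (u : nat -> V)
    (t : nat -> R) :
  (forall i j, (i <= j)%N -> `|u i - u j| ^+ 2 <= t i) -> t @ \oo --> (0 : R) ->
  cvg (u @ \oo).
Proof.
move=> ut t0; apply/cauchy_cvgP/cauchy_exP => e e0.
have /cvgrPdist_lt/(_ (e ^+ 2))[|N _ tN] := t0; first by rewrite exprn_gt0.
exists (u N); rewrite /= nbhs_filterE; exists N => // j /= Nj.
rewrite -ball_normE /=.
rewrite -(@ltr_pXn2r _ 2) ?nnegrE ?normr_ge0 ?(ltW e0)//.
apply: le_lt_trans (ut _ _ Nj) _.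
by have := tN N (leqnn N); rewrite sub0r normrN; apply: le_lt_trans; rewrite ler_norm.
Qed.

Context {X Y : hilbertType R}.
Implicit Types (p q : X * Y) (S : nat -> set (X * Y)).

Definition sqn p : R := `|p.1| ^+ 2 + `|p.2| ^+ 2.

Lemma sqn_ge0 p : 0 <= sqn p.
Proof. by rewrite addr_ge0 ?sqr_ge0. Qed.

(** This is the parallelogram law, written with the midpoint because midpoints stay in the sets
    considered. *)
Lemma sqnB p q : sqn (p - q) = 2 * sqn p + 2 * sqn q - 4 * sqn (2^-1 *: (p + q)).
Proof.
rewrite /sqn /= !sqr_normZ !sqr_normB !sqr_normD.
by field.
Qed.

(* The parallelogram law makes almost-minimal elements a Cauchy sequence; this
   replaces weak compactness of bounded sets. *)
Lemma min_norm_sequence S (c : R) :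
  (forall m n, (m <= n)%N -> S n `<=` S m) ->
  (forall n p q, S n p -> S n q -> S n (2^-1 *: (p + q))) ->
  (forall n, exists2 p, S n p & sqn p <= c) ->
  exists (p : nat -> X * Y) (l : X * Y),
    [/\ forall n, S n (p n),
        forall n q, S n q -> sqn (p n) <= sqn q + n.+1%:R^-1,
        (fun n => (p n).1) @ \oo --> l.1 & (fun n => (p n).2) @ \oo --> l.2].
Proof.
move=> Sdecr Smid Sne.
pose T n := [set sqn q | q in S n].
have Tinf n : has_inf (T n).
  split; first by have [q Sq _] := Sne n; exists (sqn q), q.
  by exists 0 => _ [q _ <-]; exact: sqn_ge0.
pose m n := inf (T n).
have mlb n q : S n q -> m n <= sqn q.
  by move=> Sq; apply: ge_inf; [case: (Tinf n)|exists q].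
have mle n : m n <= c.
  by have [q Sq qc] := Sne n; exact: le_trans (mlb _ _ Sq) qc.
have mnd : nondecreasing_seq m.
  move=> i j ij; apply: lb_le_inf; first by case: (Tinf j).
  by move=> _ [q Sq <-]; apply: mlb; exact: Sdecr Sq.
have mcvg : cvgn m.
  by apply: nondecreasing_is_cvgn => //; exists c => _ [n _ <-]; exact: mle.
pose M : R := limn m.
have mM n : m n <= M by exact: nondecreasing_cvgn_le.
have inv0 (n : nat) : 0 < (n.+1%:R : R)^-1 by rewrite invr_gt0 ltr0Sn.
have /choice[p pP] n : exists q, S n q /\ sqn q <= m n + n.+1%:R^-1.
  have [_ [q Sq <-] qm] := inf_adherent (inv0 n) (Tinf n).
  by exists q; split=> //; exact: ltW.
have Sp n : S n (p n) by case: (pP n).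
have pm n : sqn (p n) <= m n + n.+1%:R^-1 by case: (pP n).
(* For [i <= j] the midpoint of [p i] and [p j] lies in [S i], so [sqnB] bounds their squared
   distance by [2 (m i + 1/(i+1)) + 2 (m j + 1/(j+1)) - 4 m i], where [m j <= M]; the factor 6 is
   generous. *)
pose t n : R := 2 * (M - m n) + 6 * n.+1%:R^-1.
have t0 : t @ \oo --> (0 : R).
  rewrite [X in _ --> X](_ : 0 = 2 * (M - M) + 6 * 0); last by ring.
  apply: cvgD; apply: cvgMr.
    by apply: cvgB => //; exact: cvg_cst.
  exact: cvg_harmonic.
have pt i j : (i <= j)%N -> sqn (p i - p j) <= t i.
  move=> ij; rewrite sqnB /t.
  have h1 := mlb i _ (Smid _ _ _ (Sp i) (Sdecr _ _ ij _ (Sp j))).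
  have h2 : (j.+1%:R : R)^-1 <= i.+1%:R^-1.
    by rewrite lef_pV2 ?posrE ?ltr0Sn// ler_nat.
  move: h1 h2 (pm i) (pm j) (mM j) (inv0 i).
  have aux (a b d m1 m2 M' r s : R) : m1 <= d -> s <= r -> a <= m1 + r ->
    b <= m2 + s -> m2 <= M' -> 0 < r ->
    2 * a + 2 * b - 4 * d <= 2 * (M' - m1) + 6 * r by lra.
  exact: aux.
have c1 : cvg ((fun n => (p n).1) @ \oo).
  apply: (cvg_of_tail_bound _ _ t) => // i j /pt; apply: le_trans.
  by rewrite /sqn lerDl sqr_ge0.
have c2 : cvg ((fun n => (p n).2) @ \oo).
  apply: (cvg_of_tail_bound _ _ t) => // i j /pt; apply: le_trans.
  by rewrite /sqn lerDr sqr_ge0.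
exists p, (lim ((fun n => (p n).1) @ \oo), lim ((fun n => (p n).2) @ \oo)).
split=> // n q Sq; apply: le_trans (pm n) _.
by rewrite lerD2r; exact: mlb.
Qed.

Lemma cvg_sqn (p : nat -> X * Y) (l : X * Y) :
  (fun n => (p n).1) @ \oo --> l.1 -> (fun n => (p n).2) @ \oo --> l.2 ->
  (fun n => sqn (p n)) @ \oo --> sqn l.
Proof.
move=> p1 p2; rewrite /sqn.
under eq_fun do rewrite !expr2.
by rewrite !expr2; apply: cvgD; apply: cvgM; exact: cvg_norm.
Qed.

End MinimizingSequences.

(** * Riesz representation of continuous linear forms *)

Section Riesz.
Context {R : realType} {V : hilbertType R}.

(** The element [w] of minimal norm in the hyperplane [l = 1] is orthogonal to the kernel of [l],
    and [w] divided by its squared norm represents [l]. *)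
Lemma riesz_representation (l : V -> R) :
  scalar l -> continuous l -> exists w, forall u, l u = inner w u.
Proof.
move=> ls lc.
have lD u v : l (u + v) = l u + l v by rewrite -[u]scale1r ls mul1r scale1r.
have l_0 : l 0 = 0 by apply: (addrI (l 0)); rewrite -lD !addr0.
have lZ a u : l (a *: u) = a * l u by rewrite -[a *: u]addr0 ls l_0 addr0.
have lN u : l (- u) = - l u by rewrite -scaleN1r lZ mulN1r.
have [l0|/existsNP[u0 lu0]] := pselect (forall u, l u = 0).
  by exists 0 => u; rewrite l0 innerC inner0r.
pose u1 := (l u0)^-1 *: u0.
have lu1 : l u1 = 1 by rewrite lZ mulVf//; exact/eqP.
(* [min_norm_sequence] works on pairs, so the hyperplane is placed in [V * V] with a free second
   component; comparisons use pairs [(u, 0)]. *)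
pose S := fun _ : nat => [set p : V * V | l p.1 = 1].
have Smid (n : nat) (p q : V * V) : S n p -> S n q -> S n (2^-1 *: (p + q)).
  by move=> lp lq; rewrite /S /= lZ lD lp lq -[1 + 1]/(2%:R) mulVf.
have [p [q [Sp pmin p1 p2]]] := min_norm_sequence S (sqn (u1, 0))
  (fun _ _ _ _ => id) Smid (fun _ => ex_intro2 _ _ (u1, 0) lu1 (lexx _)).
pose w := q.1.
have lw : l w = 1.
  have : (fun n => l (p n).1) @ \oo --> l w by exact: (cvg_comp _ _ p1 (lc w)).
  rewrite (_ : (fun n => _) = cst 1); last by apply/funext => n; exact: Sp.
  by move=> h; apply/esym; move: h; apply: cvg_unique => //; exact: cvg_cst.
have wmin u : l u = 1 -> `|w| ^+ 2 <= `|u| ^+ 2.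
  move=> lu.
  have h : (fun n => sqn (p n)) @ \oo --> sqn q by exact: cvg_sqn.
  apply: (@le_trans _ _ (sqn q)); first by rewrite /sqn lerDl sqr_ge0.
  have h2 : (fun n => sqn (u, 0 : V) + n.+1%:R^-1) @ \oo --> sqn (u, 0 : V) + 0.
    by apply: cvgD; [exact: cvg_cst|exact: cvg_harmonic].
  have := ler_lim (cvgP _ h) (cvgP _ h2).
  rewrite (cvg_lim _ h)// (cvg_lim _ h2)// => qle.
  have -> : `|u| ^+ 2 = sqn (u, 0 : V) + 0.
    by rewrite /sqn /= normr0 expr0n /= !addr0.
  by apply: qle; apply: nearW => n; apply: pmin.
have worth k : l k = 0 -> inner w k = 0.
  move=> lk.
  have h (s : R) : 0 <= s ^+ 2 * `|k| ^+ 2 + 2 * (s * inner w k).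
    have := wmin (w + s *: k); rewrite lD lZ lk lw mulr0 addr0.
    move=> /(_ erefl); rewrite sqr_normD sqr_normZ innerE; lra.
  have [k0|k0] := eqVneq k 0; first by rewrite k0 inner0r.
  have n0 : 0 < `|k| ^+ 2 by rewrite exprn_gt0 ?normr_gt0.
  (* This [s] minimizes the quadratic in [h]; the minimal value is [- inner w k ^+ 2] over the
     squared norm of [k], hence must be zero. *)
  have := h (- inner w k / `|k| ^+ 2).
  rewrite (_ : _ + _ = - (inner w k ^+ 2 / `|k| ^+ 2)); last first.
    by field; rewrite -normr_eq0 in k0; rewrite k0.
  rewrite oppr_ge0 => h1.
  have : inner w k ^+ 2 / `|k| ^+ 2 == 0.
    by rewrite eq_le h1 divr_ge0 ?sqr_ge0.
  by rewrite mulf_eq0 invr_eq0 (gt_eqF n0) orbF sqrf_eq0 => /eqP.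
have w0 : `|w| ^+ 2 != 0.
  rewrite sqrf_eq0 normr_eq0; apply/eqP => w0.
  by move: lw; rewrite w0 l_0 => /esym/eqP; rewrite oner_eq0.
exists (`|w| ^- 2 *: w) => u; rewrite innerE.
have := worth (u - l u *: w); rewrite lD lN lZ lw mulr1 subrr.
move=> /(_ erefl); rewrite !innerE inner_norm => /eqP.
by rewrite subr_eq0 => /eqP ->; field; rewrite -sqrf_eq0.
Qed.

End Riesz.

(** * First-order conditions for a proximal step *)

Lemma inner_continuous {R : realType} {V : hilbertType R} (w : V) :
  continuous (inner w).
Proof.
move=> u; apply/cvgrPdist_le => e e0 /=.
have w1 : 0 < `|w| + 1 by rewrite ltr_wpDl.
near=> v.
rewrite -linearBr ler_norml; apply/andP; split.
  rewrite lerNl -linearNr opprB; apply: le_trans (cauchy_schwarz _ _) _.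
  apply: (@le_trans _ _ ((`|w| + 1) * `|u - v|)).
    by rewrite distrC ler_wpM2r// lerDl.
  rewrite -ler_pdivlMl// mulrC.
  by near: v; apply: cvgr_dist_le; [exact: cvg_id | rewrite divr_gt0].
apply: le_trans (cauchy_schwarz _ _) _.
apply: (@le_trans _ _ ((`|w| + 1) * `|u - v|)).
  by rewrite ler_wpM2r// lerDl.
rewrite -ler_pdivlMl// mulrC.
by near: v; apply: cvgr_dist_le; [exact: cvg_id | rewrite divr_gt0].
Unshelve. all: by end_near. Qed.

(** If [s < 0], the chosen step [t] satisfies [t |Q| < - s], so the linear term wins and the
    expression is negative. *)
Lemma first_order_nonneg {R : realType} (s Q : R) :
  (forall t, 0 < t <= 1 -> 0 <= t * s + t ^+ 2 * Q) -> 0 <= s.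
Proof.
move=> h; rewrite leNgt; apply/negP => s0.
have n0 : 0 <= `|Q| by [].
have nQ : Q <= `|Q| by exact: ler_norm.
pose t := - s / (- s + `|Q| + 1).
have d0 : 0 < - s + `|Q| + 1 by lra.
have t0 : 0 < t by rewrite divr_gt0// oppr_gt0.
have t1 : t <= 1 by rewrite /t ler_pdivrMr//; lra.
have := h t; rewrite t0 t1 => /(_ isT).
rewrite expr2 -mulrA -mulrDr pmulr_rge0//.
have : t * (- s + `|Q| + 1) = - s by rewrite /t; field; rewrite gt_eqF.
have : t * Q <= t * `|Q| by rewrite ler_pM2l.
nra.
Qed.

Section ProximalStep.
Context {R : realType} {V Z : hilbertType R}.

Lemma fin_num_proper (phi : V -> \bar R) (u : V) :
  proper_fun phi -> phi u != +oo%E -> phi u \is a fin_num.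
Proof. by move=> [pN _] pu; rewrite fin_numE pN. Qed.

(* Strong convexity in S0 is only available along subgradients, so the linear
   form in the first-order condition has to be represented by a vector. *)
Lemma proximal_step_ineq (phi : V -> \bar R) (mu : R) (C : {linear V -> Z})
    (lt r : Z) (th c e : R) (v0 vt : V)
    (q := fun u => inner lt (r + C (u - v0)) + th / 2 * `|r + C (u - v0)| ^+ 2 +
       c * `|u - vt| ^+ 2 + e / 2 * `|u| ^+ 2) :
  S0 mu phi -> continuous C -> phi v0 \is a fin_num ->
  (forall u, phi u \is a fin_num ->
     fine (phi v0) + q v0 <= fine (phi u) + q u) ->
  forall u, phi u \is a fin_num ->
    fine (phi v0) + mu / 2 * `|u - v0| ^+ 2 <=
    fine (phi u) + inner (lt + th *: r) (C (u - v0)) +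
      2 * c * inner (v0 - vt) (u - v0) + e * inner v0 (u - v0).
Proof.
move=> [pphi _ _ cphi sphi] Cc fv0 qmin.
(* [l] is the derivative of the smooth part [q] at [v0]. *)
pose l d := inner (lt + th *: r) (C d) + 2 * c * inner (v0 - vt) d +
  e * inner v0 d.
have ls : scalar l.
  by move=> a d d'; rewrite /l linearP !innerDr !innerZr; ring.
have lc : continuous l.
  move=> d; rewrite /l; apply: cvgD; [apply: cvgD|].
  - exact: (cvg_comp _ _ (Cc d) (inner_continuous _ _)).
  - by apply: cvgMr; exact: inner_continuous.
  - by apply: cvgMr; exact: inner_continuous.
have [w lw] := riesz_representation l ls lc.
have main u : phi u \is a fin_num -> fine (phi v0) <= fine (phi u) + l (u - v0).
  move=> fu; pose d := u - v0.
  rewrite -subr_ge0.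
  (* Minimality is tested at [v0 + t (u - v0)]: convexity of [phi] gives the term linear in [t], and
     the quadratic parts of [q] give the term in [t ^+ 2]. *)
  apply: (first_order_nonneg _
    (th / 2 * `|C d| ^+ 2 + c * `|d| ^+ 2 + e / 2 * `|d| ^+ 2)).
  move=> t /andP[t0 t1].
  pose ut := t *: u + (1 - t) *: v0.
  have utE : ut = v0 + t *: d.
    by rewrite /ut /d scalerBl scale1r scalerBr addrCA addrC -addrA.
  have := cphi u v0 t; rewrite (ltW t0) t1 => /(_ isT).
  rewrite -/ut -(fineK fu) -(fineK fv0) -!EFinM -EFinD => utle.
  have fut : phi ut \is a fin_num.
    apply: fin_num_proper => //; apply/negP => /eqP h.
    by move: utle; rewrite h leye_eq.
  have := qmin ut fut; move: utle; rewrite -(fineK fut) lee_fin /= /q.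
  rewrite subrr linear0 addr0.
  have -> : ut - v0 = t *: d by rewrite utE addrAC subrr add0r.
  have -> : ut - vt = (v0 - vt) + t *: d by rewrite utE addrAC.
  rewrite -/d /l; move: (fine (phi ut)) (fine _) (fine _) utE => cc b a ->.
  move: d (v0 - vt) => d vv; rewrite linearZ_LR !sqr_normD !sqr_normZ.
  rewrite !innerDl !innerZl !innerDr !innerZr; lra.
move=> u fu.
(* By [main], minus the Riesz vector of [l] is a subgradient at [v0], so the strong convexity
   inequality of [S0] applies to it. *)
have : subdifferential phi v0 (- w).
  move=> v; have [v_oo|v_fin] := eqVneq (phi v) +oo%E; first by rewrite v_oo leey.
  have fv := fin_num_proper _ _ pphi v_fin.
  rewrite -(fineK fv) -(fineK fv0) -EFinD lee_fin innerNl -lw.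
  by have := main v fv; lra.
move=> /(sphi u); rewrite -(fineK fu) -(fineK fv0) -!EFinB lee_fin /=.
by rewrite innerNl -lw /l; lra.
Qed.

End ProximalStep.

(** * Almost solutions and the minimal norm solution *)

Lemma fin_num_addr_lty {R : realType} (s t : \bar R) :
  s != -oo%E -> t != -oo%E -> (s + t < +oo)%E ->
  s \is a fin_num /\ t \is a fin_num.
Proof. by case: s => [s||]; case: t => [t||]. Qed.

(** Splits a strict lower bound on a sum into one per summand, so that lower semicontinuity of [f]
    and of [g] can be applied separately. *)
Lemma lt_adde_split {R : realType} (c : R) (s t : \bar R) :
  s != -oo%E -> t != -oo%E -> (c%:E < s + t)%E ->
  exists a b : R, [/\ (a%:E < s)%E, (b%:E < t)%E & c < a + b].
Proof.
case: s => [s||] //; case: t => [t||] // _ _; rewrite ?lte_fin => cst.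
- by exists (s - (s + t - c) / 3), (t - (s + t - c) / 3); split;
    rewrite ?lte_fin; lra.
- by exists (s - 1), (c - s + 2); split; rewrite ?lte_fin ?ltry//; lra.
- by exists (c - t + 2), (t - 1); split; rewrite ?lte_fin ?ltry//; lra.
- by exists (c + 1), 0; split; rewrite ?ltry//; lra.
Qed.

Lemma convex_midpoint {R : realType} {V : hilbertType R} (phi : V -> \bar R)
    (u v : V) :
  proper_fun phi -> convex_efun phi ->
  phi u \is a fin_num -> phi v \is a fin_num ->
  phi (2^-1 *: (u + v)) \is a fin_num /\
  fine (phi (2^-1 *: (u + v))) <= (fine (phi u) + fine (phi v)) / 2.
Proof.
move=> pphi cphi fu fv; have := cphi u v 2^-1.
have -> : 1 - 2^-1 = 2^-1 :> R by lra.
have -> : 0 <= (2^-1 : R) <= 1 by rewrite invr_ge0 ler0n invf_le1 ?ler1n ?ltr0n.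
move=> /(_ isT); rewrite -scalerDr -(fineK fu) -(fineK fv) -!EFinM -EFinD.
move=> h.
have fm : phi (2^-1 *: (u + v)) \is a fin_num.
  by apply: fin_num_proper => //; apply/negP => /eqP m; rewrite m leye_eq in h.
by split=> //; move: h; rewrite -(fineK fm) lee_fin /=; lra.
Qed.

Section MinimalNormSolution.
Context {R : realType} {X Y Z : hilbertType R}.
Variables (f : X -> \bar R) (g : Y -> \bar R).
Variables (A : {linear X -> Z}) (B : {linear Y -> Z}) (b : Z).
Hypotheses (f_proper : proper_fun f) (g_proper : proper_fun g).
Hypotheses (f_lsc : lower_semicontinuous f) (g_lsc : lower_semicontinuous g).
Hypotheses (f_convex : convex_efun f) (g_convex : convex_efun g).
Hypotheses (A_cont : continuous A) (B_cont : continuous B).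
Implicit Types p q : X * Y.

Lemma pnorm_sqn p : pnorm p = Num.sqrt (sqn p).
Proof. by []. Qed.

Lemma sqnN p : sqn (- p) = sqn p.
Proof. by rewrite /sqn /= !normrN. Qed.

(** A single tolerance governs both the excess over [m] and the constraint violation, so that the
    sets are nested in [d] as well as midpoint-convex. *)
Definition almost_solutions (m d : R) : set (X * Y) :=
  [set q | [/\ f q.1 \is a fin_num, g q.2 \is a fin_num,
     fine (f q.1) + fine (g q.2) <= m + d & `|A q.1 + B q.2 - b| <= d]].

Lemma almost_solutions_midpoint m d p q :
  almost_solutions m d p -> almost_solutions m d q ->
  almost_solutions m d (2^-1 *: (p + q)).
Proof.
move=> [fp gp vp rp] [fq gq vq rq].
have [fm fmle] := convex_midpoint f _ _ f_proper f_convex fp fq.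
have [gm gmle] := convex_midpoint g _ _ g_proper g_convex gp gq.
split=> //=; first by lra.
rewrite !linearZ_LR !linearD /=.
rewrite [X in _ - X](_ : b = 2^-1 *: b + 2^-1 *: b); last first.
  by rewrite -mulr2n -scaler_nat scalerA mulfV// scale1r.
rewrite (addrACA (2^-1 *: A p.1)) opprD (addrACA _ _ (- _)) -2!scalerDr -2!scalerBr.
apply: le_trans (ler_normD _ _) _; rewrite !normrZ.
have -> : `|2^-1 : R| = 2^-1 by rewrite ger0_norm ?invr_ge0.
lra.
Qed.

(** Feasibility passes to the limit by continuity of [A] and [B], the value bound by lower
    semicontinuity of each summand. *)
Lemma almost_solutions_limit (m : R) (p : nat -> X * Y) q :
  (forall n, almost_solutions m n.+1%:R^-1 (p n)) ->
  (fun n => (p n).1) @ \oo --> q.1 -> (fun n => (p n).2) @ \oo --> q.2 ->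
  A q.1 + B q.2 = b /\ (f q.1 + g q.2 <= m%:E)%E.
Proof.
move=> Sp p1 p2; split.
  have cr : (fun n => A (p n).1 + B (p n).2 - b) @ \oo --> A q.1 + B q.2 - b.
    apply: cvgB; last exact: cvg_cst.
    apply: cvgD; first exact: (cvg_comp _ _ p1 (A_cont _)).
    exact: (cvg_comp _ _ p2 (B_cont _)).
  have c0 : (fun n => A (p n).1 + B (p n).2 - b) @ \oo --> (0 : Z).
    apply/cvgr0Pnorm_le => e e0.
    have /cvgrPdist_le/(_ e e0)[N _ Ne] := @cvg_harmonic R.
    exists N => // n /= Nn; case: (Sp n) => _ _ _; move=> /le_trans; apply.
    by have := Ne n Nn; rewrite sub0r normrN; apply: le_trans; rewrite ler_norm.
  by apply/eqP; rewrite -subr_eq0; apply/eqP; exact: (cvg_unique _ cr c0).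
rewrite leNgt; apply/negP => /lt_adde_split.
move=> /(_ (proj1 f_proper _) (proj1 g_proper _)) [a1 [a2 [fa ga lta]]].
have [U /p1 U1 fU] := f_lsc _ _ fa; have [W /p2 W1 gW] := g_lsc _ _ ga.
have e0 : 0 < (a1 + a2 - m) by lra.
have /cvgrPdist_lt/(_ _ e0) h := @cvg_harmonic R.
near \oo => n.
have [fn gn vn _] := Sp n.
have : (a1%:E < f (p n).1)%E by apply: fU; near: n.
have : (a2%:E < g (p n).2)%E by apply: gW; near: n.
rewrite -(fineK fn) -(fineK gn) !lte_fin.
have : `|0 - n.+1%:R^-1| < a1 + a2 - m by near: n.
rewrite sub0r normrN => /(le_lt_trans (ler_norm _)).
have aux (u v r : R) : u + v <= m + r -> r < a1 + a2 - m -> a2 < v -> a1 < u ->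
  False by lra.
exact: aux vn.
Unshelve. all: by end_near. Qed.

(** Almost-minimal elements [p n] of the shrinking sets converge to a solution [l], whose norm is at
    least that of [pbar]. The midpoint of [q] and [pbar] is again an almost solution, so its norm is
    nearly that large too, and the parallelogram law brings [q] close to [pbar]. *)
Lemma solution_near_projection (pbar : X * Y) :
  is_proj (solutions f g A B b) 0 pbar ->
  f pbar.1 \is a fin_num -> g pbar.2 \is a fin_num ->
  forall e, 0 < e -> exists2 d, 0 < d & forall q,
    almost_solutions (fine (f pbar.1) + fine (g pbar.2)) d q ->
    sqn q <= sqn pbar + d -> sqn (q - pbar) <= e.
Proof.
move=> [[bar_feas bar_opt] bar_min] fbar gbar e e0.
pose m := fine (f pbar.1) + fine (g pbar.2).
pose S (n : nat) := almost_solutions m n.+1%:R^-1.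
have Smon d1 d2 : d1 <= d2 -> almost_solutions m d1 `<=` almost_solutions m d2.
  by move=> d12 q [? ? ? ?]; split=> //; lra.
have barS d : 0 <= d -> almost_solutions m d pbar.
  by move=> d0; split=> //; [rewrite lerDl|rewrite bar_feas subrr normr0].
have inv0 (n : nat) : 0 < (n.+1%:R : R)^-1 by rewrite invr_gt0 ltr0Sn.
have Sdecr (i j : nat) : (i <= j)%N -> S j `<=` S i.
  by move=> ij; apply: Smon; rewrite lef_pV2 ?posrE ?ltr0Sn// ler_nat.
have [p [l [Sp pmin p1 p2]]] := min_norm_sequence S (sqn pbar) Sdecr
  (fun _ _ _ => almost_solutions_midpoint m _ _ _)
  (fun n => ex_intro2 _ _ pbar (barS _ (ltW (inv0 n))) (lexx _)).
have [l_feas l_val] := almost_solutions_limit m p l Sp p1 p2.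
have l_sol : solutions f g A B b l.
  split=> // q qfeas; apply: le_trans (bar_opt q qfeas).
  by apply: le_trans l_val _; rewrite EFinD !fineK.
have barl : sqn pbar <= sqn l.
  have := bar_min l l_sol; rewrite !pnorm_sqn !sub0r !sqnN ler_sqrt//.
  exact: sqn_ge0.
have cl := cvg_sqn p l p1 p2.
(* The total error is [2 d] from the norm of [q], plus four times the error of [sqn (p n)], plus
   four times the minimality slack: at most ten sixteenths of [e]. *)
have e16 : 0 < e / 16 by lra.
have /cvgrPdist_lt/(_ _ e16) h1 := cl.
have /cvgrPdist_lt/(_ _ e16) h2 := @cvg_harmonic R.
near \oo => n.
have hn1 : sqn l - sqn (p n) < e / 16.
  by apply: le_lt_trans (ler_norm _) _; near: n.
have hn2 : (n.+1%:R : R)^-1 < e / 16.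
  apply: le_lt_trans (ler_norm _) _; rewrite -normrN -sub0r; near: n.
  exact: h2.
exists (Num.min n.+1%:R^-1 (e / 16)); first by rewrite lt_min inv0.
move=> q Sq qn.
have d1 : Num.min n.+1%:R^-1 (e / 16) <= n.+1%:R^-1 by rewrite ge_min lexx.
have d2 : Num.min n.+1%:R^-1 (e / 16) <= e / 16 by rewrite ge_min lexx orbT.
have := pmin n _ (almost_solutions_midpoint _ _ _ _ (Smon _ _ d1 _ Sq)
  (barS _ (ltW (inv0 n)))).
rewrite sqnB; move: (Num.min _ _) d2 qn (_^-1) hn2 => d d2 qn r hn2.
lra.
Unshelve. all: by end_near. Qed.

End MinimalNormSolution.

(** * Descent inequality for one block of variables *)

Section OneStep.
Context {R : realType} {V Z : hilbertType R}.
Variables (mu delta gamma a b e : R).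
Hypotheses (mu0 : 0 <= mu) (delta0 : 0 < delta) (gamma0 : 0 < gamma).
Hypotheses (dg : 0 <= delta * gamma - 1) (a0 : 0 < a) (b0 : 0 < b) (e0 : 0 <= e).
Variables (v v' z z' : V).
Hypothesis z'E : z' = (gamma + a^-1) *: v' - a^-1 *: v.
Let eta := gamma + a^-1 + mu * delta * b.
Let vt := v + eta^-1 *: (z - gamma *: v).
Let W (x y vbar : V) := delta *: y + (1 - delta * gamma) *: x - vbar.

(** The factor [eta] cancels its inverse in [vt], and the definition of [z'] absorbs [gamma + a^-1].
    What is left are increments of [z] and [v], which can be polarized into differences of squared
    distances. *)
Lemma prox_direction u :
  delta * a * b * (2 * (eta / (2 * a * b)) * inner (v' - vt) u) =
  delta * inner (z' - z) u + mu * delta ^+ 2 * b * inner (v' - v) u.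
Proof.
have eta0 : eta != 0.
  rewrite gt_eqF// ltr_wpDr ?addr_gt0 ?invr_gt0//.
  by rewrite !mulr_ge0// ltW.
rewrite z'E /vt !innerE.
have : eta = gamma + a^-1 + mu * delta * b by [].
move: eta eta0 => et et0 etE.
have -> : mu * delta ^+ 2 * b = delta * (et - gamma - a^-1) by rewrite etE; ring.
by field; rewrite et0 !gt_eqF.
Qed.

Variables (fx fx' fbar : R) (C : {linear V -> Z}) (lam' ls : Z) (vbar : V).
Let slope u := 2 * (eta / (2 * a * b)) * inner (v' - vt) u.
Let gap (t : R) (x : V) := t - fbar + inner ls (C (x - vbar)).
Let drift (c : R) (x y : V) :=
  2^-1 * `|W x y vbar| ^+ 2 + (delta * gamma - 1) / 2 * `|x - vbar| ^+ 2 +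
  mu * delta * c / 2 * `|x - vbar| ^+ 2.

(* The optimality inequality is tested at the reference point with weight
   [delta * a * b] and at the previous iterate with weight [delta ^+ 2 * b]; the
   weighted test directions add up to a multiple of [W v' z' vbar]. The coefficient
   of [mu] in [drift] is arranged so that the strong convexity term absorbs the
   growth of [b]. *)
Lemma component_descent :
  fx' + mu / 2 * `|vbar - v'| ^+ 2 <=
    fbar + inner lam' (C (vbar - v')) + slope (vbar - v') +
    e * inner v' (vbar - v') ->
  fx' + mu / 2 * `|v - v'| ^+ 2 <=
    fx + inner lam' (C (v - v')) + slope (v - v') + e * inner v' (v - v') ->
  (delta ^+ 2 * b + delta * a * b) * (gap fx' v' + e / 2 * `|v'| ^+ 2) +
    inner (lam' - ls) (delta * a * b *: C (v' - vbar) +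
                       (delta ^+ 2 * b) *: C (v' - v)) +
    drift (delta * b + a * b) v' z' <=
  delta ^+ 2 * b * (gap fx v + e / 2 * `|v| ^+ 2) + drift (delta * b) v z +
    delta * a * b * (e / 2) * `|vbar| ^+ 2.
Proof.
(* Everything is rewritten in terms of [v'], [d], [p] and [P]. Since [delta ^+ 2 * b] is [tau] times
   [delta * a * b], the weighted directions combine into [p + tau *: d], the new value of [W]. *)
pose d := v' - v; pose p := v' - vbar; pose tau := delta / a.
pose P := W v' z' vbar - W v z vbar.
have tau0 : 0 < tau by rewrite divr_gt0.
have -> : vbar - v' = - p by rewrite opprB.
have -> : v - v' = - d by rewrite opprB.
have slopeE u : delta * a * b * slope u = inner P u +
    (delta * gamma - 1 + mu * delta ^+ 2 * b) * inner d u.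
  by rewrite prox_direction /P /W /d !innerE; ring.
have W'E : W v' z' vbar = p + tau *: d.
  apply: inner_inj => u; rewrite /W z'E /p /d /tau !innerE; field.
  by rewrite gt_eqF.
have WE : W v z vbar = (p + tau *: d) - P by rewrite -W'E /P subKr.
have gapE : v - vbar = p - d by apply: inner_inj => u; rewrite !innerE; ring.
have vE : v = v' - d by rewrite subKr.
have vbarE : vbar = v' - p by rewrite subKr.
rewrite /drift W'E WE /gap gapE -/p -/d.
have -> : `|v| ^+ 2 = `|v' - d| ^+ 2 by rewrite -vE.
have -> : `|vbar| ^+ 2 = `|v' - p| ^+ 2 by rewrite -vbarE.
move: (slopeE (- p)) (slopeE (- d)); move: (slope _) (slope _) => sd sp.
(* The nonnegative remainders to be discarded: squares left by polarizing the products with [P], [d]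
   and [v']. In [d0], the half comes from [inner d p] and [tau] from the test at the previous
   iterate. *)
have P0 : 0 <= `|P| ^+ 2 by [].
have d0 : 0 <= (delta * gamma - 1 + mu * delta * (delta * b)) * (2^-1 + tau) * `|d| ^+ 2.
  apply: mulr_ge0 => //; apply: mulr_ge0; last by rewrite addr_ge0 ?invr_ge0// ltW.
  exact: addr_ge0 dg (mulr_ge0 (mulr_ge0 mu0 (ltW delta0)) (ltW (mulr_gt0 delta0 b0))).
have c0 : 0 < delta * a * b by rewrite !mulr_gt0.
have ep0 : 0 <= delta * a * b * (e / 2) * `|p| ^+ 2.
  by rewrite !mulr_ge0 ?invr_ge0// ltW.
have ed0 : 0 <= delta * a * b * tau * (e / 2) * `|d| ^+ 2.
  by rewrite !mulr_ge0 ?invr_ge0// ltW.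
move=> slp sld I1 I2.
have md0 : 0 <= delta * a * b * tau * (mu / 2) * `|d| ^+ 2.
  by rewrite !mulr_ge0 ?invr_ge0// ltW.
have J1 := ler_wpM2l (ltW c0) I1.
have J2 := ler_wpM2l (ltW (mulr_gt0 c0 tau0)) I2.
have deltaE : delta = a * tau by rewrite /tau; field; rewrite gt_eqF.
have CN u : C (- u) = - C u by exact: linearN.
have CB u w : C (u - w) = C u - C w by exact: linearB.
have sldt : tau * _ = tau * _ := congr1 (fun t => tau * t) sld.
move: J1 J2 slp sldt ep0 ed0 md0 d0 P0; clearbody d p tau P.
rewrite !CN !CB !normrN !sqr_normB !sqr_normD !sqr_normZ !innerE.
rewrite (innerC d p) (innerC P p) (innerC P d) -!inner_norm deltaE.
lra.
Qed.

End OneStep.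

(** * Weighted sums and limits of real sequences *)

Section ScalarSequences.
Context {R : realType}.

Lemma summable_tail (w : nat -> R) :
  (forall k, (1 <= k)%N -> 0 <= w k) -> (\sum_(1 <= k <oo) (w k)%:E < +oo)%E ->
  forall e : R, 0 < e -> exists2 N, (1 <= N)%N &
    forall n, (N <= n)%N -> \sum_(N <= k < n) w k <= e.
Proof.
move=> w0 wfin e e0.
pose s n := \sum_(1 <= k < n.+1) w k.
have snd : nondecreasing_seq s.
  apply/nondecreasing_seqP => n; rewrite /s [leRHS]big_nat_recr//= lerDl.
  exact: w0.
have sle n : ((s n)%:E <= \sum_(1 <= k <oo) (w k)%:E)%E.
  rewrite /s -sumEFin; apply: nneseries_lim_ge => k k1 _.
  by rewrite lee_fin w0.
have sfin : (\sum_(1 <= k <oo) (w k)%:E)%E \is a fin_num.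
  rewrite ge0_fin_numE//; apply: nneseries_ge0 => k k1 _; by rewrite lee_fin w0.
have scvg : cvgn s.
  apply: nondecreasing_is_cvgn => //.
  exists (fine (\sum_(1 <= k <oo) (w k)%:E)%E) => _ [n _ <-].
  by rewrite -lee_fin fineK//; exact: sle.
have /cvgrPdist_le/(_ _ e0)[N _ Ne] := scvg.
exists N.+1 => // -[//|n] Nn.
have : `|limn s - s N| <= e by exact: Ne (leqnn N).
move=> /(le_trans (ler_norm _)).
have : s n <= limn s by exact: nondecreasing_cvgn_le.
have -> : s n = s N + \sum_(N.+1 <= k < n.+1) w k.
  by rewrite /s (big_cat_nat _ Nn).
have aux (l a b : R) : a + b <= l -> l - a <= e -> b <= e by lra.
exact: aux.
Qed.

(* Kronecker's lemma, for nonnegative terms. *)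
Lemma weighted_sum_small (b w : nat -> R) :
  (forall k, (1 <= k)%N -> 0 < b k) -> (forall k, (1 <= k)%N -> b k <= b k.+1) ->
  b @ \oo --> +oo -> (forall k, (1 <= k)%N -> 0 <= w k) ->
  (\sum_(1 <= k <oo) (w k)%:E < +oo)%E ->
  forall c0 c e : R, 0 <= c -> 0 < e -> exists N, forall n, (N <= n)%N ->
    c0 + c * \sum_(2 <= k < n) b k * w k <= e * b n.
Proof.
move=> b0 bnd boo w0 wfin c0 c e c_ge0 e0.
(* Half of [e] pays for the fixed head of the sum, half for the tail; [c + 1] keeps the denominator
   positive when [c = 0]. *)
have e1 : 0 < e / (2 * (c + 1)) by rewrite divr_gt0// mulr_gt0//; lra.
have [N0 N01 hN0] := summable_tail w w0 wfin _ e1; clear wfin.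
pose N := maxn N0 2.
have bmono i j : (1 <= i)%N -> (i <= j)%N -> b i <= b j.
  move=> i1; elim: j => [|j IH]; first by rewrite leqn0 => /eqP ->.
  rewrite leq_eqVlt => /predU1P[->//|]; rewrite ltnS => ij.
  by apply: le_trans (IH ij) (bnd _ _); exact: leq_trans i1 ij.
pose h := c0 + c * \sum_(2 <= k < N) b k * w k.
have /cvgryPge/(_ (h / (e / 2)))[N1 _ hN1] := boo.
exists (maxn N N1) => n; rewrite geq_max => /andP[Nn N1n].
have N2 : (2 <= N)%N by rewrite leq_maxr.
have n1 : (1 <= n)%N by apply: leq_trans Nn; exact: leq_trans N2.
rewrite (big_cat_nat N2 Nn) /= mulrDr addrA -/h.
have h1 : h <= e / 2 * b n.
  have := hN1 n N1n; rewrite /= ler_pdivrMr; last by lra.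
  by rewrite mulrC.
have h2 : \sum_(N <= k < n) b k * w k <= b n * \sum_(N <= k < n) w k.
  rewrite mulr_sumr; apply: ler_sum_nat => k /andP[Nk kn].
  have k1 : (1 <= k)%N by apply: leq_trans Nk; exact: leq_trans N2.
  by apply: ler_wpM2r; [exact: w0|exact: bmono (ltnW kn)].
have h3 : \sum_(N <= k < n) w k <= e / (2 * (c + 1)).
  apply: le_trans (hN0 n _); last by apply: leq_trans Nn; rewrite leq_maxl.
  have N0N : (N0 <= N)%N by rewrite leq_maxl.
  rewrite [leRHS](big_cat_nat N0N Nn) /= lerDr.
  rewrite big_nat; apply: sumr_ge0 => k /andP[N0k kN].
  by apply: w0; exact: leq_trans N01 N0k.
have h4 : c * (e / (2 * (c + 1))) <= e / 2.
  rewrite (_ : _ * _ = e / 2 * (c / (c + 1))); last by field; rewrite gt_eqF//; lra.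
  by rewrite ler_piMr ?ler_pdivrMr; lra.
have bn0 := b0 n n1.
have : c * \sum_(N <= k < n) b k * w k <= b n * (e / 2).
  apply: le_trans (ler_wpM2l c_ge0 h2) _; rewrite mulrCA ler_pM2l//.
  by apply: le_trans h4; exact: ler_wpM2l.
lra.
Qed.

Lemma eventually_le_of_cvg0 (u : nat -> R) : (forall n, 0 <= u n) ->
  (forall e, 0 < e -> exists N, forall n, (N <= n)%N -> u n <= e) ->
  u @ \oo --> (0 : R).
Proof.
move=> u0 h; apply/cvgrPdist_le => e /h[N hN]; exists N => // n /= Nn.
by rewrite sub0r normrN ger0_norm// hN.
Qed.

(** Every tail infimum is already zero, so the limit inferior is that of a constant sequence. *)
Lemma limn_einf_eq0 (u : nat -> R) : (forall n, 0 <= u n) ->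
  (forall N e, 0 < e -> exists2 n, (N <= n)%N & u n <= e) ->
  limn_einf (fun n => (u n)%:E) = 0%E.
Proof.
move=> u0 h; rewrite limn_einf_lim.
rewrite (_ : einfs _ = cst 0%E) ?lim_cst//.
apply/funext => N /=; apply/eqP; rewrite eq_le; apply/andP; split; last first.
  by apply: le_ereal_inf_tmp => _ [n _ <-]; rewrite lee_fin.
apply/lee_addgt0Pr => e e0; rewrite add0e.
have [n Nn un] := h N e e0.
apply: le_trans (ereal_inf_lbound _) _; first by exists n.
by rewrite lee_fin.
Qed.

End ScalarSequences.

(** * From multiplier bounds to residual bounds *)

Section DualResidual.
Context {R : realType} {Z : normedModType R}.

(** If the growth condition held with equality, [delta * b k * r k - lam k] would be constant. The
    inequality makes it a convex combination instead, which preserves a norm bound; adding [lam k]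
    back costs the second [M k]. *)
Lemma dual_residual_bound (delta : R) (a b : nat -> R) (r lam : nat -> Z)
    (K : nat) (M : nat -> R) :
  0 < delta -> (forall k, (K <= k)%N -> 0 < a k) -> (forall k, (K <= k)%N -> 0 < b k) ->
  (forall k, (K <= k)%N -> delta * b k.+1 <= delta * b k + a k * b k) ->
  (forall k, (K <= k)%N -> lam k.+1 - lam k =
    (delta * b k + a k * b k) *: r k.+1 - (delta * b k) *: r k) ->
  (forall k, (K <= k)%N -> `|lam k| <= M k) ->
  (forall k, (K <= k)%N -> M k <= M k.+1) ->
  exists c, forall k, (K <= k)%N -> delta * b k * `|r k| <= c + 2 * M k.
Proof.
move=> delta0 a0 b0 hb hlam lamM Mnd.
(* [u k.+1] is a convex combination of [u k] and [- lam k.+1]. *)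
pose u k := (delta * b k) *: r k - lam k.
have uM k : (K <= k)%N -> `|u k| <= `|u K| + M k.
  elim: k => [|k IH].
    by rewrite leqn0 => /eqP K0; rewrite -K0 lerDl (le_trans _ (lamM K _)).
  rewrite leq_eqVlt => /predU1P[<-|]; first by rewrite lerDl (le_trans _ (lamM K _)).
  rewrite ltnS => Kk.
  pose c := delta * b k + a k * b k.
  have c0 : 0 < c by rewrite addr_gt0// mulr_gt0 ?a0 ?b0.
  pose t := delta * b k.+1 / c.
  have t0 : 0 <= t.
    by rewrite divr_ge0// ?(ltW c0)// mulr_ge0// ltW// b0// ltnW.
  have t1 : t <= 1 by rewrite ler_pdivrMr// mul1r hb.
  have tc : t * c = delta * b k.+1 by rewrite /t mulfVK// gt_eqF.
  clearbody t.
  have -> : u k.+1 = t *: u k - (1 - t) *: lam k.+1.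
    have cr : c *: r k.+1 = u k + lam k.+1.
      rewrite /u addrAC -addrA.
      by rewrite [lam k.+1 - _]hlam// addrC subrK.
    have -> : u k.+1 = t *: (c *: r k.+1) - lam k.+1.
      by rewrite scalerA tc.
    by rewrite cr scalerDr scalerBl scale1r opprB addrA.
  apply: le_trans (ler_normB _ _) _; rewrite !normrZ !ger0_norm ?subr_ge0//.
  have h1 := ler_wpM2l t0 (IH Kk).
  have t10 : 0 <= 1 - t by rewrite subr_ge0.
  have h2 := ler_wpM2l t10 (lamM k.+1 (leqW Kk)).
  have h3 := ler_wpM2l t0 (Mnd k Kk).
  have h4 : 0 <= (1 - t) * `|u K| by rewrite mulr_ge0.
  move: h1 h2 h3 h4; lra.
exists `|u K| => k Kk.
have -> : delta * b k * `|r k| = `|u k + lam k|.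
  by rewrite /u subrK normrZ ger0_norm// mulr_ge0// ltW// b0.
apply: le_trans (ler_normD _ _) _.
have := uM k Kk; have := lamM k Kk; lra.
Qed.

End DualResidual.

(** * Saddle points and optimality conditions of the iterates *)

Section JointAlgorithm.
Context {R : realType} {X Y Z : hilbertType R}.
Variables (f : X -> \bar R) (g : Y -> \bar R).
Variables (A : {linear X -> Z}) (B : {linear Y -> Z}) (b : Z).
Hypotheses (f_proper : proper_fun f) (g_proper : proper_fun g).

(** The saddle point is feasible, so the optimal value does not exceed its value, which is the
    minimum of the Lagrangian at [ls]. *)
Lemma saddle_lower_bound (pbar : X * Y) (xs : X) (ys : Y) (ls : Z) :
  solutions f g A B b pbar -> saddle_points f g A B b (xs, ys, ls) ->
  [/\ f pbar.1 \is a fin_num, g pbar.2 \is a fin_num &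
    forall u v, f u \is a fin_num -> g v \is a fin_num ->
      fine (f pbar.1) + fine (g pbar.2) <=
      fine (f u) + fine (g v) + inner ls (A u + B v - b)].
Proof.
move=> [bar_feas bar_opt] saddle.
have [fN [u0 fu0]] := f_proper; have [gN [v0 gv0]] := g_proper.
have fin_le (u u' : X) (v v' : Y) (s t : R) :
    f u' \is a fin_num -> g v' \is a fin_num ->
    (f u + g v + s%:E <= f u' + g v' + t%:E)%E ->
    f u \is a fin_num /\ g v \is a fin_num.
  move=> fu gv le_uv; apply: fin_num_addr_lty => //.
  rewrite -(fineK fu) -(fineK gv) -!EFinD in le_uv.
  by have := le_lt_trans le_uv (ltry _); rewrite !ltey; apply: contra => /eqP ->.
have fu0' := fin_num_proper _ _ f_proper fu0.
have gv0' := fin_num_proper _ _ g_proper gv0.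
have [fxs gys] := fin_le _ _ _ _ _ _ fu0' gv0' (saddle u0 v0 ls).2.
have s_feas : A xs + B ys = b.
  set r := A xs + B ys - b.
  (* Shifting the multiplier by the residual [r] raises the Lagrangian by the squared norm of [r],
     which must therefore vanish. *)
  have := (saddle u0 v0 (ls + r)).1; rewrite /lagrangian -/r.
  rewrite -(fineK fxs) -(fineK gys) -!EFinD lee_fin lerD2l innerDl gerDl.
  rewrite inner_norm => r0; apply/eqP; rewrite -subr_eq0 -/r -normr_eq0 -sqrf_eq0.
  by rewrite eq_le r0 sqr_ge0.
have bar_le := bar_opt (xs, ys) s_feas.
have [fbar gbar] : f pbar.1 \is a fin_num /\ g pbar.2 \is a fin_num.
  by apply: (fin_le _ _ _ _ 0 0 fxs gys); rewrite !adde0.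
split=> // u v fu gv.
have := (saddle u v ls).2; rewrite /lagrangian s_feas subrr inner0r.
move: bar_le; rewrite /= -(fineK fxs) -(fineK gys) -(fineK fbar) -(fineK gbar).
rewrite -(fineK fu) -(fineK gv) -!EFinD !lee_fin /=; lra.
Qed.

Variables (mu_f mu_g delta gamma : R) (alpha beta eps : nat -> R).
Variables (x : nat -> X) (y : nat -> Y) (lam : nat -> Z) (z : nat -> X).
Variable (h : nat -> Y).
Hypotheses (A_cont : continuous A) (B_cont : continuous B).
Hypotheses (f_S0 : S0 mu_f f) (g_S0 : S0 mu_g g).
Hypothesis beta_gt0 : forall k, (1 <= k)%N -> 0 < beta k.
Hypothesis alpha_gt0 : forall k, (1 <= k)%N -> 0 < alpha k.
Hypothesis alg : joint_algorithm f g A B b mu_f mu_g delta gamma alpha beta eps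
  x y lam z h.

Let res k := A (x k) + B (y k) - b.
Let eta mu k := gamma + (alpha k)^-1 + mu * delta * beta k.
Let dom0 : exists u v, f u \is a fin_num /\ g v \is a fin_num.
Proof.
have [_ [u0 fu0]] := f_proper; have [_ [v0 gv0]] := g_proper.
by exists u0, v0; split; exact: fin_num_proper.
Qed.

(** Inserting the formula for [z k.+1] cancels [gamma]: the extrapolated point is [x k.+1] plus
    [delta / alpha k] times the last displacement, and likewise for [y]. *)
Lemma multiplier_step k : (1 <= k)%N ->
  lam k.+1 - lam k = (delta * beta k + alpha k * beta k) *: res k.+1 -
    (delta * beta k) *: res k.
Proof.
move=> k1; have [_ _ _ /(_ k k1)[_ zE hE ->]] := alg.
have a0 : alpha k != 0 by rewrite gt_eqF// alpha_gt0.
have LE (V : hilbertType R) (C : {linear V -> Z}) (c d : R) (u w : V) :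
    C (delta *: (c *: u - d *: w) + (1 - delta * gamma) *: u) =
    delta *: (c *: C u - d *: C w) + (1 - delta * gamma) *: C u.
  by rewrite (linearD C) !(linearZ_LR C) /= (linearB C) !(linearZ_LR C).
rewrite zE hE !LE /res.
by apply: inner_inj => u; rewrite !innerE; field.
Qed.

(** Freezing one block of the joint minimizer leaves a proximal problem in the other. *)
Lemma iterate_optimality k : (1 <= k)%N ->
  [/\ f (x k.+1) \is a fin_num, g (y k.+1) \is a fin_num,
    forall u, f u \is a fin_num ->
      fine (f (x k.+1)) + mu_f / 2 * `|u - x k.+1| ^+ 2 <=
      fine (f u) + inner (lam k.+1) (A (u - x k.+1)) +
      2 * (eta mu_f k / (2 * alpha k * beta k)) *
        inner (x k.+1 - (x k + (eta mu_f k)^-1 *: (z k - gamma *: x k)))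
          (u - x k.+1) + eps k * inner (x k.+1) (u - x k.+1) &
    forall v, g v \is a fin_num ->
      fine (g (y k.+1)) + mu_g / 2 * `|v - y k.+1| ^+ 2 <=
      fine (g v) + inner (lam k.+1) (B (v - y k.+1)) +
      2 * (eta mu_g k / (2 * alpha k * beta k)) *
        inner (y k.+1 - (y k + (eta mu_g k)^-1 *: (h k - gamma *: y k)))
          (v - y k.+1) + eps k * inner (y k.+1) (v - y k.+1)].
Proof.
move=> k1; have [_ _ _ /(_ k k1)[opt _ _ _]] := alg.
(* The gradient of the augmented term turns the shifted multiplier into exactly [lam k.+1], the same
   in both blocks. *)
have lamE : lam k - (delta * beta k) *: res k +
    ((alpha k + delta) * beta k) *: res k.+1 = lam k.+1.
  rewrite -[RHS](subrK (lam k)) multiplier_step//.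
  by apply: inner_inj => u; rewrite !innerE; ring.
move: opt; rewrite /is_argmin /aug_lagrangian /lagrangian /= -/(res k).
rewrite -/(eta mu_f k) -/(eta mu_g k).
set xt := x k + _; set yt := y k + _; set lt := lam k - _.
set th := (alpha k + delta) * beta k.
set cf := eta mu_f k / _; set cg := eta mu_g k / _ => opt.
have [u0 [v0 [fu0 gv0]]] := dom0.
have [fx gy] : f (x k.+1) \is a fin_num /\ g (y k.+1) \is a fin_num.
  have := opt (u0, v0); rewrite -(fineK fu0) -(fineK gv0) -!EFinD -!addeA -!EFinD.
  move=> /le_lt_trans/(_ (ltry _)); rewrite addeA => lty.
  apply: fin_num_addr_lty; [exact: f_proper.1|exact: g_proper.1|].
  by move: lty; rewrite !ltey; apply: contra => /eqP ->.
split=> // [u fu|v gv].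
- rewrite -lamE -/lt -/th.
  apply: (proximal_step_ineq f mu_f A lt (res k.+1) th cf (eps k)) => // w fw.
  have := opt (w, y k.+1).
  rewrite -(fineK fx) -(fineK fw) -(fineK gy) -!EFinD lee_fin /=.
  have -> : A w + B (y k.+1) - b = res k.+1 + A (w - x k.+1).
    by apply: inner_inj => u'; rewrite linearB !innerE; ring.
  by rewrite subrr linear0 addr0 -/(res k.+1); lra.
- rewrite -lamE -/lt -/th.
  apply: (proximal_step_ineq g mu_g B lt (res k.+1) th cg (eps k)) => // w gw.
  have := opt (x k.+1, w).
  rewrite -(fineK fx) -(fineK gw) -(fineK gy) -!EFinD lee_fin /=.
  have -> : A (x k.+1) + B w - b = res k.+1 + B (w - y k.+1).
    by apply: inner_inj => u'; rewrite linearB !innerE; ring.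
  by rewrite subrr linear0 addr0 -/(res k.+1); lra.
Qed.

(** * Descent of the energy *)

Hypotheses (mu_f_ge0 : 0 <= mu_f) (mu_g_ge0 : 0 <= mu_g).
Hypotheses (delta_gt0 : 0 < delta) (gamma_gt0 : 0 < gamma).
Hypothesis delta_gamma : 0 <= delta * gamma - 1.
Hypothesis delta_beta : forall k, (1 <= k)%N ->
  delta * beta k.+1 <= delta * beta k + alpha k * beta k.
Hypothesis eps_ge0 : forall k, (1 <= k)%N -> 0 <= eps k.
Variables (pbar : X * Y) (ls : Z).
Hypotheses (bar_feas : A pbar.1 + B pbar.2 = b).
Hypotheses (fbar : f pbar.1 \is a fin_num) (gbar : g pbar.2 \is a fin_num).

Definition lagrangian_gap k := fine (f (x k)) + fine (g (y k)) -
  (fine (f pbar.1) + fine (g pbar.2)) + inner ls (res k).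

Let drift {V : hilbertType R} (c mu : R) (u w ubar : V) : R :=
  2^-1 * `|delta *: w + (1 - delta * gamma) *: u - ubar| ^+ 2 +
  (delta * gamma - 1) / 2 * `|u - ubar| ^+ 2 +
  mu * delta * c / 2 * `|u - ubar| ^+ 2.

Definition energy_distance k :=
  drift (delta * beta k) mu_f (x k) (z k) pbar.1 +
  drift (delta * beta k) mu_g (y k) (h k) pbar.2 +
  delta / 2 * `|lam k - ls| ^+ 2.

Lemma energy_distance_ge k : (1 <= k)%N ->
  delta / 2 * `|lam k - ls| ^+ 2 <= energy_distance k.
Proof.
move=> k1; rewrite lerDr.
have dr0 (V : hilbertType R) mu (u w ubar : V) : 0 <= mu ->
    0 <= drift (delta * beta k) mu u w ubar.
  move=> mu0; have bk := beta_gt0 k k1.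
  rewrite /drift; apply: addr_ge0; last first.
    by rewrite mulr_ge0// mulr_ge0 ?invr_ge0// !mulr_ge0// ltW.
  by apply: addr_ge0; apply: mulr_ge0; rewrite ?invr_ge0// mulr_ge0 ?invr_ge0.
by rewrite addr_ge0 ?dr0.
Qed.

(* Starts at k = 2 because [f (x 1)] and [g (y 1)] may be infinite. *)
Lemma energy_descent k : (2 <= k)%N ->
  (delta ^+ 2 * beta k + delta * alpha k * beta k) *
    (lagrangian_gap k.+1 + eps k / 2 * sqn (x k.+1, y k.+1)) +
    energy_distance k.+1 <=
  delta ^+ 2 * beta k * (lagrangian_gap k + eps k / 2 * sqn (x k, y k)) +
    energy_distance k + delta * alpha k * beta k * (eps k / 2) * sqn pbar.
Proof.
case: k => [//|j] j1; set k := j.+1; have k1 : (1 <= k)%N by [].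
have [fx gy _ _] := iterate_optimality j j1.
have [fx' gy' optx opty] := iterate_optimality k k1.
have [_ _ _ /(_ k k1)[_ zE hE _]] := alg.
have b0 := beta_gt0 k k1; have a0 := alpha_gt0 k k1; have e0 := eps_ge0 k k1.
have cx := component_descent mu_f delta gamma (alpha k) (beta k) (eps k)
  mu_f_ge0 delta_gt0 gamma_gt0 delta_gamma a0 b0 e0 (x k) (x k.+1) (z k) (z k.+1)
  zE (fine (f (x k))) (fine (f (x k.+1))) (fine (f pbar.1)) A
  (lam k.+1) ls pbar.1 (optx _ fbar) (optx _ fx).
have cy := component_descent mu_g delta gamma (alpha k) (beta k) (eps k)
  mu_g_ge0 delta_gt0 gamma_gt0 delta_gamma a0 b0 e0 (y k) (y k.+1) (h k) (h k.+1)
  hE (fine (g (y k))) (fine (g (y k.+1))) (fine (g pbar.2)) B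
  (lam k.+1) ls pbar.2 (opty _ gbar) (opty _ gy).
move: cx cy; clear optx opty zE hE.
rewrite -/(drift (delta * beta k + alpha k * beta k) mu_f (x k.+1) (z k.+1) pbar.1).
rewrite -/(drift (delta * beta k + alpha k * beta k) mu_g (y k.+1) (h k.+1) pbar.2).
rewrite -/(drift (delta * beta k) mu_f (x k) (z k) pbar.1).
rewrite -/(drift (delta * beta k) mu_g (y k) (h k) pbar.2).
(* [component_descent] ends with the coefficient [delta * beta k + alpha k * beta k]; the growth
   condition lowers it to [delta * beta k.+1]. *)
have drift_mono (V : hilbertType R) mu (u w ubar : V) : 0 <= mu ->
    drift (delta * beta k.+1) mu u w ubar <=
    drift (delta * beta k + alpha k * beta k) mu u w ubar.
  move=> mu0; rewrite /drift lerD2l ler_wpM2r// ler_wpM2r ?invr_ge0//.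
  by rewrite ler_wpM2l ?delta_beta// mulr_ge0// ltW.
have := drift_mono X mu_f (x k.+1) (z k.+1) pbar.1 mu_f_ge0.
have := drift_mono Y mu_g (y k.+1) (h k.+1) pbar.2 mu_g_ge0.
have gapE j' : inner ls (A (x j' - pbar.1)) + inner ls (B (y j' - pbar.2)) =
    inner ls (res j').
  by rewrite /res -bar_feas (linearB A) (linearB B) /= !innerE; ring.
(* Summed over both blocks, the multiplier terms reproduce the update of [lam], and polarization
   turns them into the dual part of the energy. *)
have dualE : inner (lam k.+1 - ls) ((delta * alpha k * beta k) *: A (x k.+1 - pbar.1) +
      (delta ^+ 2 * beta k) *: A (x k.+1 - x k)) +
    inner (lam k.+1 - ls) ((delta * alpha k * beta k) *: B (y k.+1 - pbar.2) +
      (delta ^+ 2 * beta k) *: B (y k.+1 - y k)) =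
    delta * inner (lam k.+1 - ls) (lam k.+1 - lam k).
  rewrite multiplier_step// /res -bar_feas.
  rewrite !(linearB A) !(linearB B) /= !innerE; ring.
have polar : delta * inner (lam k.+1 - ls) (lam k.+1 - lam k) =
    delta / 2 * `|lam k.+1 - ls| ^+ 2 + delta / 2 * `|lam k.+1 - lam k| ^+ 2 -
    delta / 2 * `|lam k - ls| ^+ 2.
  have -> : lam k - ls = (lam k.+1 - ls) - (lam k.+1 - lam k).
    by apply: inner_inj => u; rewrite !innerE; ring.
  by rewrite (sqr_normB (lam k.+1 - ls)); field.
have P0 : 0 <= delta / 2 * `|lam k.+1 - lam k| ^+ 2.
  by rewrite mulr_ge0// mulr_ge0 ?invr_ge0// ltW.
rewrite /energy_distance /lagrangian_gap /sqn -!gapE /=.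
move: (drift _ _ _ _ _) (drift _ _ _ _ _) (drift _ _ _ _ _) (drift _ _ _ _ _)
  (drift _ _ _ _ _) (drift _ _ _ _ _) => d1 d2 d3 d4 d5 d6.
move: dualE; move: (inner _ (_ + _)) (inner _ (_ + _)) => i1 i2.
move: polar P0; move: (inner (lam k.+1 - ls) _) => i3.
move: (inner ls _) (inner ls _) (inner ls _) (inner ls _) => j1' j2 j3 j4.
move: (fine _) (fine _) (fine _) (fine _) (fine _) (fine _) => f1 f2 f3 f4 f5 f6.
lra.
Qed.

(** * Asymptotics of the gap, the residual and the norms *)

Hypothesis saddle_bound : forall u v, f u \is a fin_num -> g v \is a fin_num ->
  fine (f pbar.1) + fine (g pbar.2) <=
  fine (f u) + fine (g v) + inner ls (A u + B v - b).
Hypothesis beta_nondecr : forall k, (1 <= k)%N -> beta k <= beta k.+1.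
Hypothesis beta_lim : beta @ \oo --> +oo.
Hypothesis eps_nonincr : forall k, (1 <= k)%N -> eps k.+1 <= eps k.
Hypothesis alpha_eps_sum : (\sum_(1 <= k <oo) (alpha k * eps k)%:E < +oo)%E.
Hypothesis beta_eps_lim : (fun k => beta k * eps k) @ \oo --> +oo.

Lemma lagrangian_gap_ge0 k : (2 <= k)%N -> 0 <= lagrangian_gap k.
Proof.
case: k => [//|j] j1; have [fx gy _ _] := iterate_optimality j j1.
by rewrite /lagrangian_gap; have := saddle_bound _ _ fx gy; rewrite -/(res _); lra.
Qed.

Lemma energy_distance_ge0 k : (1 <= k)%N -> 0 <= energy_distance k.
Proof.
move=> k1; apply: le_trans (energy_distance_ge k k1).
by rewrite mulr_ge0// mulr_ge0 ?invr_ge0// ltW.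
Qed.

Lemma energy_weight k : (1 <= k)%N ->
  delta ^+ 2 * beta k.+1 <= delta ^+ 2 * beta k + delta * alpha k * beta k.
Proof.
by move=> k1; have := ler_wpM2l (ltW delta_gt0) (delta_beta k k1); lra.
Qed.

(** [H] is the energy at index 2 plus the accumulated perturbations of [energy_descent]; Kronecker's
    lemma makes it small relative to [beta]. *)
Lemma energy_bound : exists H : nat -> R,
  [/\ forall k, (2 <= k)%N ->
      delta ^+ 2 * beta k * lagrangian_gap k + energy_distance k <= H k,
    forall k, (2 <= k)%N -> H k <= H k.+1 &
    forall e, 0 < e -> exists N, forall n, (N <= n)%N -> H n <= e * beta n].
Proof.
pose energy k := delta ^+ 2 * beta k *
  (lagrangian_gap k + eps k / 2 * sqn (x k, y k)) + energy_distance k.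
pose c := delta / 2 * sqn pbar.
have c0 : 0 <= c by rewrite mulr_ge0 ?sqn_ge0// mulr_ge0 ?invr_ge0// ltW.
pose H n := energy 2 + c * \sum_(2 <= k < n) beta k * (alpha k * eps k).
have HS k : (2 <= k)%N -> H k.+1 = H k + c * (beta k * (alpha k * eps k)).
  by move=> k2; rewrite /H big_nat_recr//= mulrDr addrA.
have ae0 k : (1 <= k)%N -> 0 <= alpha k * eps k.
  by move=> k1; rewrite mulr_ge0 ?eps_ge0// ltW// alpha_gt0.
have energyH k : (2 <= k)%N -> energy k <= H k.
  elim: k => [//|k IH]; rewrite leq_eqVlt => /predU1P[<-|].
    by rewrite /H big_geq// mulr0 addr0.
  rewrite ltnS => k2; have k1 := ltnW k2; rewrite HS//.
  apply: le_trans (lerD (IH k2) (lexx _)).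
  have := energy_descent k k2.
  have g0 := lagrangian_gap_ge0 k.+1 (leqW k2).
  have n0 := sqn_ge0 (x k.+1, y k.+1).
  have h1 : lagrangian_gap k.+1 + eps k.+1 / 2 * sqn (x k.+1, y k.+1) <=
            lagrangian_gap k.+1 + eps k / 2 * sqn (x k.+1, y k.+1).
    by rewrite lerD2l ler_wpM2r// ler_wpM2r ?invr_ge0// eps_nonincr.
  have h0 : 0 <= lagrangian_gap k.+1 + eps k.+1 / 2 * sqn (x k.+1, y k.+1).
    by rewrite addr_ge0// mulr_ge0// mulr_ge0 ?invr_ge0// eps_ge0.
  have w0 : 0 <= delta ^+ 2 * beta k.+1.
    by rewrite mulr_ge0 ?exprn_ge0// ltW// beta_gt0.
  have := ler_pM w0 h0 (energy_weight k k1) h1.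
  by rewrite /energy /c; lra.
exists H; split.
- move=> k k2; apply: le_trans (energyH k k2).
  rewrite /energy lerD2r ler_wpM2l//.
    by rewrite mulr_ge0 ?exprn_ge0 ?(ltW delta_gt0)// ltW// beta_gt0// ltnW.
  by rewrite lerDl mulr_ge0 ?sqn_ge0// mulr_ge0 ?invr_ge0// eps_ge0// ltnW.
- move=> k k2; have k1 := ltnW k2; rewrite HS// lerDl mulr_ge0//.
  by rewrite mulr_ge0 ?ae0// ltW// beta_gt0.
- by move=> e e0; apply: weighted_sum_small.
Qed.

Lemma lagrangian_gap_small e : 0 < e ->
  exists N, forall n, (N <= n)%N -> lagrangian_gap n <= e.
Proof.
move=> e0; have [H [energyH _ Hsmall]] := energy_bound.
have d2 : 0 < delta ^+ 2 by rewrite exprn_gt0.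
have [N hN] := Hsmall (delta ^+ 2 * e) (mulr_gt0 d2 e0).
exists (maxn N 2) => n; rewrite geq_max => /andP[Nn n2].
have b0 := beta_gt0 n (ltnW n2).
have := energyH n n2; have := hN n Nn; have := energy_distance_ge0 n (ltnW n2).
move=> h1 h2 h3; rewrite -(ler_pM2l (mulr_gt0 d2 b0)).
by move: h1 h2 h3; lra.
Qed.

Lemma residual_small e : 0 < e -> exists N, forall n, (N <= n)%N -> `|res n| <= e.
Proof.
move=> e0; have [H [energyH Hnd Hsmall]] := energy_bound.
(* Derived from [s <= 1 + s ^+ 2]. This crude bound avoids square roots and suffices, since the
   residual is multiplied by [delta * beta k]. *)
pose M k := 1 + 2 / delta * H k.
have lamM k : (2 <= k)%N -> `|lam k - ls| <= M k.
  move=> k2; have k1 := ltnW k2.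
  have lam2 : delta / 2 * `|lam k - ls| ^+ 2 <= H k.
    apply: le_trans (energy_distance_ge k k1) _; apply: le_trans (energyH k k2).
    rewrite lerDr mulr_ge0 ?lagrangian_gap_ge0//.
    by rewrite mulr_ge0 ?exprn_ge0 ?(ltW delta_gt0)// ltW// beta_gt0.
  have d2 : 0 <= 2 / delta by rewrite divr_ge0// ltW.
  have := ler_wpM2l d2 lam2; rewrite mulrA.
  have -> : 2 / delta * (delta / 2) = 1 by field; rewrite gt_eqF.
  by rewrite mul1r /M; have := sqr_ge0 (`|lam k - ls| - 1); nra.
have Mnd k : (2 <= k)%N -> M k <= M k.+1.
  by move=> k2; rewrite lerD2l ler_wpM2l ?Hnd// divr_ge0// ltW.
have dual k : (2 <= k)%N -> (lam k.+1 - ls) - (lam k - ls) =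
    (delta * beta k + alpha k * beta k) *: res k.+1 - (delta * beta k) *: res k.
  by move=> k2; rewrite -(multiplier_step k (ltnW k2)) opprB addrA subrK.
have [c hc] := dual_residual_bound delta alpha beta res (fun k => lam k - ls) 2 M
  delta_gt0 (fun k k2 => alpha_gt0 k (ltnW k2)) (fun k k2 => beta_gt0 k (ltnW k2))
  (fun k k2 => delta_beta k (ltnW k2)) dual lamM Mnd.
(* With this constant the term [4 / delta * H n] of [2 * M n] takes half of [delta * e * beta n];
   the other half covers [c + 2]. *)
have e1 : 0 < delta ^+ 2 * e / 8 by rewrite divr_gt0// mulr_gt0// exprn_gt0.
have [N1 hN1] := Hsmall _ e1.
have /cvgryPge/(_ ((c + 2) / (delta * e / 2)))[N2 _ hN2] := beta_lim.
exists (maxn 2 (maxn N1 N2)) => n; rewrite !geq_max => /and3P[n2 Nn1 Nn2].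
have b0 := beta_gt0 n (ltnW n2).
rewrite -(ler_pM2l (mulr_gt0 delta_gt0 b0)).
apply: le_trans (hc n n2) _; rewrite /M.
have de : 0 < delta * e / 2 by rewrite divr_gt0// mulr_gt0.
have h2 : c + 2 <= beta n * (delta * e / 2) by rewrite -ler_pdivrMr//; exact: hN2.
have h1 : 4 / delta * H n <= delta * e / 2 * beta n.
  have d4 : 0 <= 4 / delta by rewrite divr_ge0// ltW.
  apply: le_trans (ler_wpM2l d4 (hN1 n Nn1)) _; rewrite le_eqVlt; apply/orP; left.
  by apply/eqP; field; rewrite gt_eqF.
by move: h1 h2; lra.
Qed.

(** The objective excess is the gap minus [inner ls (res n)], and the latter is controlled by the
    residual through Cauchy-Schwarz. *)
Lemma iterates_almost_solve d : 0 < d -> exists N, forall n, (N <= n)%N ->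
  almost_solutions f g A B b (fine (f pbar.1) + fine (g pbar.2)) d (x n, y n).
Proof.
move=> d0; have d2 : 0 < d / 2 by rewrite divr_gt0.
have l1 : 0 < `|ls| + 1 by rewrite ltr_wpDl.
have [N1 hN1] := lagrangian_gap_small _ d2.
have [N2 hN2] := residual_small _ (divr_gt0 d2 l1).
have [N3 hN3] := residual_small _ d0.
exists (maxn 2 (maxn N1 (maxn N2 N3))) => n.
rewrite !geq_max => /and4P[n2 Nn1 Nn2 Nn3].
case: n n2 Nn1 Nn2 Nn3 => [//|j] j1 Nn1 Nn2 Nn3.
have [fx gy _ _] := iterate_optimality j j1.
split=> //; last exact: hN3.
have h1 := hN1 _ Nn1; have h2 := hN2 _ Nn2; rewrite /lagrangian_gap in h1.
have h3 : - inner ls (res j.+1) <= d / 2.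
  rewrite -innerNr; apply: le_trans (cauchy_schwarz _ _) _; rewrite normrN.
  rewrite ler_pdivlMr// in h2; apply: le_trans h2.
  by rewrite mulrC ler_wpM2l// lerDl.
by move: h1 h3; rewrite /=; lra.
Qed.

(** Subtracting [sqn pbar] inside the energy cancels the perturbation of [energy_descent] exactly.
    Outside the ball the shifted term is nonnegative, so the changes of weight and of [eps] only
    help, and the energy does not increase. *)
Lemma outer_norms_small K e : 0 < e ->
  (forall k, (K <= k)%N -> sqn pbar <= sqn (x k, y k)) ->
  exists N, forall n, (N <= n)%N -> sqn (x n, y n) <= sqn pbar + e.
Proof.
move=> e0 outer; pose K2 := maxn K 2.
have K2_2 : (2 <= K2)%N by rewrite leq_maxr.
have outer2 k : (K2 <= k)%N -> 0 <= sqn (x k, y k) - sqn pbar.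
  by rewrite geq_max subr_ge0 => /andP[+ _]; exact: outer.
pose energy k := delta ^+ 2 * beta k *
  (lagrangian_gap k + eps k / 2 * (sqn (x k, y k) - sqn pbar)) +
  energy_distance k.
have energy_le k : (K2 <= k)%N -> energy k <= energy K2.
  elim: k => [|k IH]; first by rewrite leqn0 => /eqP ->.
  rewrite leq_eqVlt => /predU1P[<-//|]; rewrite ltnS => Kk.
  have k2 : (2 <= k)%N := leq_trans K2_2 Kk; have k1 := ltnW k2.
  apply: le_trans (IH Kk); have := energy_descent k k2.
  have g0 := lagrangian_gap_ge0 k.+1 (leqW k2).
  have n0 := outer2 k.+1 (leqW Kk).
  have h1 : lagrangian_gap k.+1 + eps k.+1 / 2 * (sqn (x k.+1, y k.+1) - sqn pbar) <=
            lagrangian_gap k.+1 + eps k / 2 * (sqn (x k.+1, y k.+1) - sqn pbar).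
    by rewrite lerD2l ler_wpM2r// ler_wpM2r ?invr_ge0// eps_nonincr.
  have h0 : 0 <= lagrangian_gap k.+1 +
            eps k.+1 / 2 * (sqn (x k.+1, y k.+1) - sqn pbar).
    by rewrite addr_ge0// mulr_ge0// mulr_ge0 ?invr_ge0// eps_ge0.
  have w0 : 0 <= delta ^+ 2 * beta k.+1.
    by rewrite mulr_ge0 ?exprn_ge0 ?(ltW delta_gt0)// ltW// beta_gt0.
  have := ler_pM w0 h0 (energy_weight k k1) h1.
  by rewrite /energy; lra.
have d2 : 0 < delta ^+ 2 / 2 * e by rewrite mulr_gt0// divr_gt0// exprn_gt0.
(* The added 1 makes the comparison strict: an excess of at least [e] at step [n] would push the
   energy above [energy K2]. *)
have /cvgryPge/(_ (energy K2 / (delta ^+ 2 / 2 * e) + 1))[N _ hN] := beta_eps_lim.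
exists (maxn K2 N) => n; rewrite geq_max => /andP[Kn Nn].
have n2 : (2 <= n)%N := leq_trans K2_2 Kn; have n1 := ltnW n2.
have := energy_le n Kn; rewrite /energy.
have b0 := beta_gt0 n n1.
have dg0 : 0 <= delta ^+ 2 * beta n * lagrangian_gap n.
  by rewrite mulr_ge0 ?lagrangian_gap_ge0// mulr_ge0 ?exprn_ge0 ?(ltW delta_gt0)// ltW.
have q0 := energy_distance_ge0 n n1.
rewrite -/(energy K2) => en.
have be : energy K2 < beta n * eps n * (delta ^+ 2 / 2 * e).
  rewrite -ltr_pdivrMr//; apply: lt_le_trans (hN n Nn).
  by rewrite ltrDl.
have be0 : 0 <= beta n * eps n by rewrite mulr_ge0 ?eps_ge0// ltW.
rewrite leNgt; apply/negP => lt_e.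
have d2' : 0 <= delta ^+ 2 / 2 by rewrite divr_ge0 ?exprn_ge0 ?(ltW delta_gt0).
have lt_e' : e <= sqn (x n, y n) - sqn pbar by move: lt_e; lra.
have := ler_wpM2l (mulr_ge0 be0 d2') lt_e'.
by move: en be dg0 q0; lra.
Qed.

End JointAlgorithm.

(** * Convergence to the minimal norm solution *)

Theorem theorem3 (R : realType) (X Y Z : hilbertType R)
  (f : X -> \bar R) (g : Y -> \bar R)
  (A : {linear X -> Z}) (B : {linear Y -> Z}) (b : Z)
  (mu_f mu_g delta gamma : R) (alpha beta eps : nat -> R)
  (x : nat -> X) (y : nat -> Y) (lam : nat -> Z) (z : nat -> X) (h : nat -> Y)
  (xs : X) (ys : Y) (ls : Z) (xbar : X) (ybar : Y)
  (A_cont : continuous A) (B_cont : continuous B)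
  (mu_f_ge0 : 0 <= mu_f) (mu_g_ge0 : 0 <= mu_g)
  (f_S0 : S0 mu_f f) (g_S0 : S0 mu_g g)
  (solvable : solutions f g A B b !=set0)
  (beta_gt0 : forall k, (1 <= k)%N -> 0 < beta k)
  (beta_nondecr : forall k, (1 <= k)%N -> beta k <= beta k.+1)
  (beta_lim : beta @ \oo --> +oo)
  (alpha_gt0 : forall k, (1 <= k)%N -> 0 < alpha k)
  (delta_gt0 : 0 < delta) (gamma_gt0 : 0 < gamma)
  (delta_gamma : 0 <= delta * gamma - 1)
  (delta_beta : forall k, (1 <= k)%N ->
     delta * beta k.+1 <= delta * beta k + alpha k * beta k)
  (xyl_alg : joint_algorithm f g A B b mu_f mu_g delta gamma alpha beta eps
     x y lam z h)
  (saddle : saddle_points f g A B b (xs, ys, ls))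
  (eps_ge0 : forall k, (1 <= k)%N -> 0 <= eps k)
  (eps_nonincr : forall k, (1 <= k)%N -> eps k.+1 <= eps k)
  (alpha_eps_sum : (\sum_(1 <= k <oo) (alpha k * eps k)%:E < +oo)%E)
  (beta_eps_lim : (fun k => beta k * eps k) @ \oo --> +oo)
  (bar_proj : is_proj (solutions f g A B b) 0 (xbar, ybar)) :
  limn_einf (fun k => (pnorm ((x k, y k) - (xbar, ybar)))%:E) = 0%E /\
  ((exists2 K : nat, (1 <= K)%N &
      (forall k, (K <= k)%N ->
         pball 0 (Num.sqrt (`|xbar| ^+ 2 + `|ybar| ^+ 2)) (x k, y k)) \/
      (forall k, (K <= k)%N ->
         (~` pball 0 (Num.sqrt (`|xbar| ^+ 2 + `|ybar| ^+ 2))) (x k, y k))) ->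
   (fun k => pnorm ((x k, y k) - (xbar, ybar))) @ \oo --> (0 : R)).
Proof.
have [f_proper _ f_lsc f_convex _] := f_S0.
have [g_proper _ g_lsc g_convex _] := g_S0.
pose pbar := (xbar, ybar).
have [fbar gbar saddle_bound] :=
  saddle_lower_bound f g A B b f_proper g_proper pbar _ _ _ (proj1 bar_proj) saddle.
have bar_feas : A pbar.1 + B pbar.2 = b by case: bar_proj => -[].
have almost := iterates_almost_solve f g A B b f_proper g_proper mu_f mu_g delta
  gamma alpha beta eps x y lam z h A_cont B_cont f_S0 g_S0 beta_gt0 alpha_gt0
  xyl_alg mu_f_ge0 mu_g_ge0 delta_gt0 gamma_gt0 delta_gamma delta_beta eps_ge0
  pbar ls bar_feas fbar gbar saddle_bound beta_nondecr beta_lim eps_nonincr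
  alpha_eps_sum.
have outer := outer_norms_small f g A B b f_proper g_proper mu_f mu_g delta
  gamma alpha beta eps x y lam z h A_cont B_cont f_S0 g_S0 beta_gt0 alpha_gt0
  xyl_alg mu_f_ge0 mu_g_ge0 delta_gt0 gamma_gt0 delta_gamma delta_beta eps_ge0
  pbar ls bar_feas fbar gbar saddle_bound eps_nonincr beta_eps_lim.
have near_bar := solution_near_projection f g A B b f_proper g_proper f_lsc g_lsc
  f_convex g_convex A_cont B_cont pbar bar_proj fbar gbar.
pose dist k := pnorm ((x k, y k) - (xbar, ybar)).
have dist_ge0 k : 0 <= dist k by exact: sqrtr_ge0.
have dist_le e q : 0 < e -> sqn (q - pbar) <= e ^+ 2 -> pnorm (q - pbar) <= e.
  move=> e0 qe; rewrite pnorm_sqn -(ger0_norm (ltW e0)) -sqrtr_sqr.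
  by rewrite ler_sqrt ?sqr_ge0.
(* One tolerance [d] serves for both almost optimality and norm excess, so only the norm of the
   iterate remains to be checked. *)
have eventually_near e : 0 < e -> exists d N, [/\ 0 < d &
    forall k, (N <= k)%N -> sqn (x k, y k) <= sqn pbar + d -> dist k <= e].
  move=> e0; have [d d0 hd] := near_bar _ (exprn_gt0 2 e0).
  have [N hN] := almost d d0.
  by exists d, N; split=> // k Nk kd; apply: dist_le => //; apply: hd; first exact: hN.
have outer_lim K : (forall k, (K <= k)%N -> sqn pbar <= sqn (x k, y k)) ->
    dist @ \oo --> (0 : R).
  move=> out; apply: eventually_le_of_cvg0 => // e /eventually_near[d [N [d0 hN]]].
  have [N' hN'] := outer K d d0 out.
  by exists (maxn N N') => k; rewrite geq_max => /andP[Nk N'k]; apply: hN (hN' _ _).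
have inner_lim K : (forall k, (K <= k)%N -> sqn (x k, y k) <= sqn pbar) ->
    dist @ \oo --> (0 : R).
  move=> inn; apply: eventually_le_of_cvg0 => // e /eventually_near[d [N [d0 hN]]].
  exists (maxn N K) => k; rewrite geq_max => /andP[Nk Kk]; apply: hN => //.
  by apply: le_trans (inn k Kk) _; rewrite lerDl ltW.
have ballE k : pball 0 (Num.sqrt (`|xbar| ^+ 2 + `|ybar| ^+ 2)) (x k, y k) =
    (Num.sqrt (sqn (x k, y k)) < Num.sqrt (sqn pbar)) by rewrite /pball /= subr0.
split; last first.
  move=> [K _ [inn|out]].
    apply: (inner_lim K) => k /inn; rewrite ballE => /ltW.
    by rewrite ler_sqrt// sqn_ge0.
  apply: (outer_lim K) => k /out /=; rewrite ballE => /negP; rewrite -leNgt.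
  by rewrite ler_sqrt// sqn_ge0.
(* Either the iterates eventually stay outside the open ball and converge, or they enter it at
   arbitrarily late indices, where [eventually_near] applies. *)
have [[K out]|/forallNP no_outer] := pselect (exists K, forall k, (K <= k)%N ->
    sqn pbar <= sqn (x k, y k)).
  apply: limn_einf_eq0 => // N e e0.
  have /cvgrPdist_le/(_ e e0)[N' _ hN'] := outer_lim K out.
  exists (maxn N N'); first exact: leq_maxl.
  have := hN' (maxn N N') (leq_maxr _ _).
  by rewrite sub0r normrN; apply: le_trans; exact: ler_norm.
apply: limn_einf_eq0 => // N e /eventually_near[d [N' [d0 hN']]].
have /existsNP[k /not_implyP[Nk /negP]] := no_outer (maxn N N').
rewrite -ltNge => in_ball; move: Nk; rewrite geq_max => /andP[Nk N'k].
by exists k => //; apply: hN' => //; apply: le_trans (ltW in_ball) _; rewrite lerDl ltW.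
Qed.
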